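(* Let $(\Gamma,\alpha,\nabla)$ be an $n$-valent (integral abstract) GKM graph with fixed connection $\nabla$, axial function $\alpha$ and $\chi$ vertices, and assume that the absolute value of all line Chern numbers is bounded above by $\beta>0$. Put $$K=K(\beta,n,\chi)=\sqrt{\frac{(n+3)\,n\,\chi\,(\beta^2+2)^{n\chi}}{8}}.$$ (i) There exists a choice of maximal extension $\tilde\alpha\colon E\to\mathbb{Z}^k$ of $(\Gamma,\alpha,\nabla)$ for which $$\|\tilde\alpha(e)\|_\infty\le K\quad\text{for all } e\in E.$$ (ii) For each decomposition $n=i_1+\dots+i_m$ into positive integers, the corresponding combinatorial Chern number of $(\Gamma,\alpha)$ satisfies $$|c_{i_1,\dots,i_m}[\Gamma]|\le L:=\chi\cdot\big(n\,K\,(K+1)^{n-1}\big)^n\prod_{j=1}^m\binom{n}{i_j}.$$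
   Context: GKM graphs. Let $\Gamma=(V,E)$ be a finite $n$-valent graph without loops, with vertex set $V$ and set of directed edges $E\subset V\times V$ such that $e=(p,q)\in E$ iff $\bar e:=(q,p)\in E$; $i(e)=p$ and $t(e)=q$ are the initial and terminal vertices, and $E_p=\{e\in E: i(e)=p\}$ (so $|E_p|=n$). A connection $\nabla$ on $\Gamma$ is a family of bijections $\nabla_e\colon E_{i(e)}\to E_{t(e)}$, $e\in E$, with $\nabla_e(e)=\bar e$ and $(\nabla_e)^{-1}=\nabla_{\bar e}$. An integral abstract GKM graph is a pair $(\Gamma,\alpha)$ with $\alpha\colon E\to\mathbb{Z}^r$ (the axial function) such that: for every $p\in V$ and $e\ne f$ in $E_p$, $\alpha(e)$ and $\alpha(f)$ are linearly independent; $\alpha(\bar e)=-\alpha(e)$; there is a compatible connection $\nabla$, i.e. one such that for all $e\in E$, $f\in E_{i(e)}$ one has $\alpha(f)-\alpha(\nabla_e f)=c_e(f)\,\alpha(e)$ for some integer $c_e(f)$, called a line Chern number. One writes $(\Gamma,\alpha,\nabla)$ if a compatible connection is fixed. Maximal extension. Given $(\Gamma,\alpha,\nabla)$ with line Chern numbers $c_e(f)$, let $\mathcal{L}\subset\mathbb{Z}^E$ be the subgroup of all $\lambda\colon E\to\mathbb{Z}$ with $\lambda(\bar e)=-\lambda(e)$ for all $e\in E$ and $\lambda(f)-\lambda(\nabla_e f)=c_e(f)\lambda(e)$ for all $p\in V$, $e,f\in E_p$. For a $\mathbb{Z}$-basis $\gamma_1,\dots,\gamma_k$ of $\mathcal{L}$,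 the map $\gamma=(\gamma_1,\dots,\gamma_k)\colon E\to\mathbb{Z}^k$ (equivalently the labelled graph $(\Gamma,\gamma)$) is called a maximal extension of $(\Gamma,\alpha,\nabla)$; different choices of basis give different choices of maximal extension (related by $\mathrm{GL}(k,\mathbb{Z})$). Combinatorial Chern numbers. Regard elements of $\mathbb{Z}^r$ as linear forms, i.e. degree-one elements of $\mathbb{Z}[x_1,\dots,x_r]$ ($=H^*(BT;\mathbb{Z})$, $T$ a torus of rank $r$). For $v\in V$ let $c^T_i(v)=\sigma_i(\alpha(e):e\in E_v)$, with $\sigma_i$ the $i$-th elementary symmetric polynomial. For $n=i_1+\dots+i_m$, $$c_{i_1,\dots,i_m}[\Gamma]=\sum_{v\in V}\frac{\prod_{j=1}^m c^T_{i_j}(v)}{\prod_{e\in E_v}\alpha(e)},$$ which is an integer. *)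

(* Defs.v *)
From HB Require Import structures.
From mathcomp Require Import all_boot all_order all_algebra.
From mathcomp Require Import fraction.
From mathcomp Require Import mpoly.

Set Implicit Arguments.
Unset Strict Implicit.
Unset Printing Implicit Defensive.

Import GRing.Theory Num.Theory.

Local Open Scope ring_scope.

Record graph (V : finType) := Graph {
  adj :> rel V;
  adj_sym : ssrbool.symmetric adj;
  adj_irr : irreflexive adj }.

Definition edges (V : finType) (G : graph V) := {e : V * V | G e.1 e.2}.

Section GKM.

Variables (V : finType) (G : graph V).
Implicit Types (e f : edges G) (p v : V).

Definition src e : V := (val e).1.
Definition dst e : V := (val e).2.

Lemma erev_subproof e : G (dst e) (src e).
Proof. by rewrite adj_sym; exact: (valP e). Qed.

Definition erev e : edges G :=
  exist (fun x : V * V => G x.1 x.2) (dst e, src e) (erev_subproof e).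

Definition star p : {set edges G} := [set e | src e == p].

Definition valent (n : nat) : Prop := forall p, #|star p| = n.

(* [nabla e f] is only meaningful for [f \in star (src e)]; there it is the
   image of [f] under the bijection [star (src e) -> star (dst e)] attached to
   [e].  The second clause, used for [e] and for [erev e], says that the maps
   attached to [e] and [erev e] are two-sided inverses of each other. *)
Definition connection (nabla : edges G -> edges G -> edges G) : Prop :=
  [/\ forall e, {in star (src e), forall f, nabla e f \in star (dst e)},
      forall e, {in star (src e), cancel (nabla e) (nabla (erev e))}
    & forall e, nabla e e = erev e].

Definition lin_indep2 (r : nat) (x y : 'rV[int]_r) : Prop :=
  forall a b : int, a *: x + b *: y = 0 -> a = 0 /\ b = 0.

(* [c e f] is the line Chern number c_e(f), for [f \in star (src e)];
   the case [f = e] is included. *)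
Definition GKM_graph (r : nat) (alpha : edges G -> 'rV[int]_r)
    (nabla : edges G -> edges G -> edges G) (c : edges G -> edges G -> int)
    : Prop :=
  [/\ forall p, {in star p &, forall e f, e != f ->
        lin_indep2 (alpha e) (alpha f)},
      forall e, alpha (erev e) = - alpha e,
      connection nabla
    & forall e, {in star (src e), forall f,
        alpha f - alpha (nabla e f) = c e f *: alpha e}].

Definition ext_lattice (nabla : edges G -> edges G -> edges G)
    (c : edges G -> edges G -> int) (l : {ffun edges G -> int}) : Prop :=
  (forall e, l (erev e) = - l e) /\
  (forall e, {in star (src e), forall f, l f - l (nabla e f) = c e f * l e}).

Definition Zbasis (M : zmodType) (L : M -> Prop) (k : nat) (b : 'I_k -> M)
    : Prop :=
  [/\ forall i, L (b i),
      forall x, L x -> exists a : 'I_k -> int, x = \sum_i b i *~ a i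
    & forall a : 'I_k -> int, \sum_i b i *~ a i = 0 -> forall i, a i = 0].

Definition maximal_extension (nabla : edges G -> edges G -> edges G)
    (c : edges G -> edges G -> int) (k : nat) (gamma : edges G -> 'rV[int]_k)
    : Prop :=
  Zbasis (ext_lattice nabla c) (fun i : 'I_k => [ffun e => gamma e 0 i]).

Definition linear_form (r : nat) (x : 'rV[int]_r) : {mpoly int[r]} :=
  \sum_(j < r) x 0 j *: 'X_j.

Definition chern_class (r : nat) (alpha : edges G -> 'rV[int]_r) (i : nat) v
    : {mpoly int[r]} :=
  (mesym #|star v| {mpoly int[r]} i).@[fun j => linear_form (alpha (enum_val j))].

Definition chern_number (r : nat) (alpha : edges G -> 'rV[int]_r) (s : seq nat)
    : {fraction {mpoly int[r]}} :=
  \sum_v tofrac (\prod_(i <- s) chern_class alpha i v)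
         / tofrac (\prod_(e in star v) linear_form (alpha e)).

End GKM.

Definition sup_norm (k : nat) (x : 'rV[int]_k) : nat := \max_(i < k) `|(x 0 i)%R|%N.

Definition Kbound (R : rcfType) (beta : R) (n chi : nat) : R :=
  Num.sqrt (((n + 3) * n * chi)%:R * (beta ^+ 2 + 2) ^+ (n * chi) / 8).

(* Main.v *)
(** Each relation defining the extension lattice is a linear equation in one
    unknown per unoriented edge, with coefficients of total absolute value at
    most [2 + beta^2].  Cramer's rule gives rational generators of the solution
    space with small minors as entries, and reducing a triangular lattice basis
    modulo the common minor keeps the entries small.  This is (i).

    For (ii), a greedy integral combination of that basis gives a solution
    [l : E -> Z] that vanishes on no edge and is still small.  On the pencil
    [l + t alpha] the Chern number is a rational function of [t] of degree 0
    whose poles are simple and cancel in pairs at the two ends of an edge.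
    Hence it is constant, and may be computed at [l], where it is visibly
    bounded.  Its integrality does not follow from localization with linear
    forms, since two labels at a vertex may share a prime factor.  Instead
    replace each label [a] by the K-theoretic class [1 - q^(l a) X^(m a)] for two
    transverse solutions [l], [m] and an integer [q].  By the same cancellation
    and Gauss's lemma the sum is a Laurent polynomial over [Z[1/q]]; at [X = 1]
    and [q = 1 + |prod l|] it is congruent to the desired number modulo
    [prod l]. *)

Require Import Defs.
From mathcomp Require Import all_boot all_order all_fingroup all_algebra.
From mathcomp Require Import all_field.
From mathcomp Require Import fraction.
From mathcomp Require Import mpoly.
From mathcomp Require Import zify ring.
From Stdlib Require Import Classical.

Set Implicit Arguments.
Unset Strict Implicit.
Unset Printing Implicit Defensive.

Import Order.TTheory GRing.Theory Num.Theory.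
Local Open Scope ring_scope.

(** * Small bases of integer kernels *)

Lemma ex_minimal (P : nat -> Prop) :
  (exists n, P n) -> exists2 n, P n & forall m, P m -> (n <= m)%N.
Proof.
case=> n; elim/ltn_ind: n => n IH Pn.
case: (classic (exists2 m, P m & (m < n)%N)) => [[m Pm lt_mn]|noP].
  exact: IH lt_mn Pm.
exists n => // m Pm; rewrite leqNgt; apply/negP => lt_mn.
by apply: noP; exists m.
Qed.

Lemma leq_sum_inj (I J : finType) (h : I -> J) (F : J -> nat) :
  injective h -> (\sum_i F (h i) <= \sum_j F j)%N.
Proof.
move=> h_inj; rewrite -(big_imset (h := h) F) /=; last by move=> x y _ _ /h_inj.
by rewrite [leqRHS](bigID (mem [set h x | x : I])) /= leq_addr.
Qed.

(** In absolute values, the Leibniz sum is the part of the expanded product of row sums that is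
    indexed by permutations. Injectivity of [g] bounds each row sum of the minor by one of [A]. *)
Lemma abs_minor_le (m N r D : nat) (A : 'M[int]_(m, N)) (f : 'I_r -> 'I_m)
    (g : 'I_r -> 'I_N) :
  injective g -> (forall i, \sum_j `|A i j|%N <= D)%N ->
  (`|\det (mxsub f g A)| <= D ^ r)%N.
Proof.
move=> g_inj hA.
have -> : (D ^ r = \prod_(i < r) D)%N by rewrite prod_nat_const card_ord.
apply: (@leq_trans (\prod_(i < r) \sum_(j < r) `|A (f i) (g j)|%N)%N); last first.
  apply: leq_prod => i _; apply: leq_trans (hA (f i)).
  exact: (leq_sum_inj (fun j => `|A (f i) j|%N)).
rewrite bigA_distr_bigA /= /determinant.
pose F (h : {ffun 'I_r -> 'I_r}) := (\prod_i `|A (f i) (g (h i))|%N)%N.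
apply: (@leq_trans (\sum_(s : 'S_r) F [ffun i => s i])); last first.
  apply: leq_sum_inj => s t /ffunP e; apply/permP => i.
  by have := e i; rewrite !ffunE.
elim/big_ind2: _ => // [x a y b h1 h2|s _].
  by apply: leq_trans (leq_add h1 h2); lia.
rewrite abszM abszX exp1n mul1n (big_morph absz abszM absz1).
by rewrite /F; apply: leq_prod => i _; rewrite mxE ffunE.
Qed.

Section LatticeReduction.

Variables (N k : nat) (P : 'rV[int]_N -> Prop) (h : 'I_k -> 'I_N).
Variables (v : 'I_k -> 'rV[int]_N) (d : int) (M : nat).
Hypothesis P0 : P 0.
Hypothesis PB : forall x y, P x -> P y -> P (x - y).
Hypothesis d_neq0 : d != 0.
Hypothesis Pv : forall j, P (v j).
Hypothesis vh : forall i j, v j 0 (h i) = if i == j then d else 0.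
Hypothesis v_span : forall x, P x -> d *: x = \sum_j x 0 (h j) *: v j.
Hypothesis v_le : forall j c, (`|v j 0%R c| <= M)%N.

Lemma lattice_opp x : P x -> P (- x).
Proof. by move=> Px; rewrite -sub0r; apply: PB. Qed.

Lemma lattice_add x y : P x -> P y -> P (x + y).
Proof. by move=> Px Py; rewrite -[y]opprK; apply/PB/lattice_opp. Qed.

Lemma lattice_scale a x : P x -> P (a *: x).
Proof.
move=> Px; have Pn : forall n : nat, P (n%:Z *: x).
  elim=> [|n IH]; first by rewrite scale0r.
  by rewrite intS scalerDl scale1r; apply: lattice_add.
case: a => n //; rewrite NegzE scaleNr; exact/lattice_opp/Pn.
Qed.

Lemma lattice_sum (I : finType) (Q : pred I) (F : I -> 'rV[int]_N) :
  (forall i, P (F i)) -> P (\sum_(i | Q i) F i).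
Proof. by move=> PF; apply: big_ind => // *; apply: lattice_add. Qed.

(* The rows of a Hermite basis on the coordinates [h], except that the entries
   after the pivot are reduced modulo [d]. *)
Lemma ex_pivot_vector (j : 'I_k) : exists x, [/\ P x,
  forall i : 'I_k, (i < j)%N -> x 0 (h i) = 0,
  0 < x 0 (h j),
  forall y, P y -> (forall i : 'I_k, (i < j)%N -> y 0 (h i) = 0) ->
    0 < y 0 (h j) -> x 0 (h j) <= y 0 (h j) &
  forall i, (`|x 0%R (h i)| <= `|d|)%N].
Proof.
pose Q n := exists2 x, P x /\ (forall i : 'I_k, (i < j)%N -> x 0 (h i) = 0) &
  (0 < n)%N /\ x 0 (h j) = n%:Z.
(* The vector [v j], up to sign, has pivot [|d|], so the minimal pivot is at most [|d|]. *)
have Qd : Q `|d|%N.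
  exists (Num.sg d *: v j); last first.
    by rewrite absz_gt0 d_neq0 mxE vh eqxx -normrEsg abszE.
  split=> [|i lt_ij]; first exact: lattice_scale.
  by rewrite mxE vh; case: eqP lt_ij => [->|]; rewrite ?ltnn ?mulr0.
have [n [x [Px x0] [n_gt0 xn]] n_min] : exists2 n, Q n & forall m, Q m -> (n <= m)%N.
  by apply: ex_minimal; exists `|d|%N.
pose y := x - \sum_(i : 'I_k | (j < i)%N) (x 0%R (h i) %/ d)%Z *: v i.
have yE i : y 0 (h i) = if (j < i)%N then (x 0%R (h i) %% d)%Z else x 0 (h i).
  rewrite !mxE summxE.
  have E l : ((x 0%R (h l) %/ d)%Z *: v l) 0 (h i) =
             if i == l then (x 0%R (h i) %/ d)%Z * d else 0.
    by rewrite mxE vh; case: eqP => [->|]; rewrite ?mulr0.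
  under eq_bigr do rewrite E.
  case: ifP => lt_ji.
    rewrite (bigD1 i) //= eqxx big1 ?addr0 => [|l /andP[_ /negPf]]; last by rewrite eq_sym => ->.
    by rewrite /modz.
  rewrite big1 ?subr0 // => l lt_jl; case: eqP => // il.
  by rewrite il lt_jl in lt_ji.
exists y; split.
- by apply: PB => //; apply: lattice_sum => i; apply: lattice_scale.
- by move=> i lt_ij; rewrite yE ltnNge (ltnW lt_ij) x0.
- by rewrite yE ltnn xn.
- move=> z Pz z0 z_gt0; rewrite yE ltnn xn -(gtz0_abs z_gt0) lez_nat.
  apply: n_min; exists z; first by split.
  by rewrite absz_gt0 gt_eqF // gtz0_abs.
- move=> i; rewrite yE; case: ltngtP => [lt_ji|lt_ij|/val_inj <-].
  + have := ltz_mod (x 0 (h i)) d_neq0; have := modz_ge0 (x 0 (h i)) d_neq0.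
    lia.
  + by rewrite x0.
  + by rewrite xn; apply: n_min.
Qed.

(** The minimal pivot vectors are triangular on the coordinates [h], hence a basis. Since [d *: b i]
    combines the [k] vectors [v j] with coefficients of size at most [|d|], cancelling [d] leaves
    entries of size at most [k * M]. *)
Lemma ex_small_basis : exists B : 'M[int]_(k, N),
  [/\ forall i, P (row i B), forall x, P x -> exists a, x = a *m B,
      forall a : 'rV_k, a *m B = 0 -> a = 0
    & forall i c, (`|B i c| <= k * M)%N].
Proof.
have [b /all_and5[Pb b0 b_gt0 b_min b_le]] := fin_all_exists ex_pivot_vector.
exists (\matrix_i b i); split.
- by move=> i; rewrite rowK.
- move=> x Px.
  have /(_ k (leqnn k)) [a ha] : forall t, (t <= k)%N ->
      exists a : 'rV[int]_k, forall i : 'I_k, (i < t)%N ->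
        (x - a *m \matrix_i b i) 0 (h i) = 0.
    elim=> [|t IH] lt_tk; first by exists 0.
    have [a ha] := IH (ltnW lt_tk).
    pose j := Ordinal lt_tk; set y := x - _ in ha.
    have Py : P y.
      apply: PB => //; rewrite mulmx_sum_row; apply: lattice_sum => i.
      by rewrite rowK; apply: lattice_scale.
    (* Euclidean division by the pivot: a positive remainder would contradict its minimality. *)
    pose q := (y 0%R (h j) %/ b j 0%R (h j))%Z.
    have Pz : P (y - q *: b j) by apply/PB/lattice_scale.
    exists (a + q *: delta_mx 0 j) => i.
    have -> : x - (a + q *: delta_mx 0 j) *m \matrix_i b i = y - q *: b j.
      by rewrite mulmxDl opprD addrA -scalemxAl -rowE rowK.
    have zlt (l : 'I_k) : (l < t)%N -> (y - q *: b j) 0 (h l) = 0.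
      by move=> lt_lt; have := ha l lt_lt; rewrite !mxE b0 // => ->; rewrite mulr0 subr0.
    rewrite ltnS leq_eqVlt => /orP[/eqP it|/zlt//].
    have -> : i = j by apply: val_inj.
    have zj : (y - q *: b j) 0 (h j) = (y 0%R (h j) %% b j 0%R (h j))%Z.
      by rewrite /modz -/q mxE; congr (_ + _); rewrite mxE [in LHS]mxE.
    have bj_neq0 : b j 0 (h j) != 0 by rewrite gt_eqF.
    have := modz_ge0 (y 0 (h j)) bj_neq0; rewrite -zj le_eqVlt => /orP[/eqP<-//|z_gt0].
    have := b_min j _ Pz zlt z_gt0.
    rewrite zj leNgt => /negP[].
    by rewrite -[X in _ < X]gtz0_abs // abszE; apply: ltz_mod.
  exists a; apply/eqP; rewrite -subr_eq0; apply/eqP.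
  set y := x - _ in ha *.
  have Py : P y.
    apply: PB => //; rewrite mulmx_sum_row; apply: lattice_sum => i.
    by rewrite rowK; apply: lattice_scale.
  (* By [v_span] a lattice vector is determined by its coordinates at [h]. *)
  have : d *: y = 0.
    by rewrite v_span // big1 // => i _; rewrite ha ?scale0r.
  move/rowP => dy0; apply/rowP => c; have := dy0 c.
  by rewrite !mxE => /eqP; rewrite mulf_eq0 (negPf d_neq0) => /eqP.
- move=> a aB0; apply/rowP => j; rewrite mxE.
  have [t] := ubnP (val j); elim: t => // t IH in j *; rewrite ltnS => le_jt.
  have : (a *m \matrix_i b i) 0 (h j) = 0 by rewrite aB0 mxE.
  rewrite mulmx_sum_row summxE (bigD1 j) //= big1 ?addr0.
    by rewrite mxE rowK => /eqP; rewrite mulf_eq0 (gt_eqF (b_gt0 j)) orbF => /eqP.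
  move=> i ij; rewrite mxE rowK.
  case: (ltngtP i j) => [lt_ij|lt_ji|/val_inj e]; last by rewrite e eqxx in ij.
  + by rewrite IH ?mul0r // (leq_trans lt_ij).
  + by rewrite b0 ?mulr0.
- move=> i c; rewrite mxE.
  have /rowP/(_ c) := v_span (Pb i); rewrite mxE summxE => E.
  have d_gt0 : (0 < `|d|)%N by rewrite absz_gt0.
  rewrite -(leq_pmul2l d_gt0) -abszM E.
  apply: (@leq_trans (\sum_(j < k) `|d| * M)%N); last first.
    by rewrite sum_nat_const card_ord mulnCA.
  elim/big_ind2: _ => // [x m y n h1 h2|j _]; first by apply: leq_trans (leq_add h1 h2); lia.
  by rewrite mxE abszM leq_mul.
Qed.

End LatticeReduction.

(** Over the rationals, a maximal free set of rows spans all the rows, so its equations imply the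
    others; having full rank, it contains a nonsingular square block. *)
Lemma ex_pivots (m N : nat) (A : 'M[int]_(m, N)) :
  exists r (f : 'I_r -> 'I_m) (g : 'I_r -> 'I_N),
  [/\ injective g, \det (mxsub f g A) != 0
    & forall x : 'cV_N, (forall l, (A *m x) (f l) 0 = 0) -> A *m x = 0].
Proof.
pose Aq : 'M[rat]_(m, N) := map_mx intr A.
pose f := maxrankfun Aq; pose Q := rowsub f Aq.
have Qfull : row_full Q^T.
  by rewrite /row_full mxrank_tr; exact: (maxrowsub_free Aq).
pose g := fullrankfun Qfull.
exists (\rank Aq), f, g; split; first exact: fullrankfun_inj.
  have := fullrowsub_unit Qfull.
  have -> : rowsub g Q^T = (map_mx intr (mxsub f g A))^T.
    by apply/matrixP => i j; rewrite !mxE.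
  by rewrite unitmx_tr unitmxE unitfE det_map_mx intr_eq0.
move=> x Ax0; have /submxP[W AqE] : (Aq <= Q)%MS by rewrite eq_maxrowsub.
suff Qx0 : Q *m map_mx intr x = 0.
  apply/colP => i; have /colP/(_ i) : map_mx intr (A *m x) = 0 :> 'cV[rat]_m.
    by rewrite map_mxM -/Aq AqE -mulmxA Qx0 mulmx0.
  by rewrite mxE [X in _ = X]mxE => /eqP; rewrite intr_eq0 => /eqP ->; rewrite mxE.
apply/colP => l; transitivity (((A *m x) (f l) 0)%:~R : rat); last by rewrite Ax0 mxE.
rewrite !mxE rmorph_sum; apply: eq_bigr => j _.
by rewrite !mxE rmorphM.
Qed.

(** Cramer's rule, by expanding along the replaced column. *)
Lemma cramer_minor (m N r : nat) (A : 'M[int]_(m, N)) (f : 'I_r -> 'I_m)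
    (g : 'I_r -> 'I_N) (i : 'I_r) (c : 'I_N) :
  (\adj (mxsub f g A) *m \col_l A (f l) c) i 0 =
  \det (mxsub f (fun l => if l == i then c else g l) A).
Proof.
rewrite (expand_det_col _ i) mxE; apply: eq_bigr => l _.
rewrite !mxE eqxx mulrC; congr (_ * (_ * \det _)).
by apply/matrixP => a b; rewrite !mxE eq_sym (negPf (neq_lift _ _)).
Qed.

(* Free coordinates are the columns outside a maximal nonzero minor; the vectors
   given by Cramer's rule have minors of [A] as entries. *)
Lemma small_kernel_basis (m N D : nat) (A : 'M[int]_(m, N)) :
  (1 < D)%N -> (forall i, \sum_j `|A i j|%N <= D)%N ->
  exists k (B : 'M[int]_(k, N)),
  [/\ (k <= N)%N, forall i, A *m (row i B)^T = 0,
      forall x : 'rV_N, A *m x^T = 0 -> exists a, x = a *m B,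
      forall a : 'rV_k, a *m B = 0 -> a = 0
    & forall i c, (`|B i c| <= D ^ N)%N].
Proof.
move=> D_gt1 hA; have [r [f [g [g_inj d_neq0 piv]]]] := ex_pivots A.
set d := \det _ in d_neq0.
pose F := ~: [set g i | i : 'I_r]; pose h (j : 'I_#|F|) := enum_val j.
have gh i j : (g i == h j) = false.
  apply/eqP => e; have := enum_valP j; rewrite -/(h j) -e inE => /negP[].
  exact: imset_f.
have cardF : (r + #|F| = N)%N.
  by have := cardsC [set g i | i : 'I_r]; rewrite card_imset // !card_ord.
pose u j i := (\adj (mxsub f g A) *m \col_l A (f l) (h j)) i 0.
pose v j : 'rV[int]_N := d *: delta_mx 0 (h j) - \sum_i u j i *: delta_mx 0 (g i).
have vE j c : v j 0 c = (if c == h j then d else 0) - \sum_i (if c == g i then u j i else 0).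
  rewrite !mxE summxE; congr (_ - _); first by rewrite eqxx /=; case: eqP; rewrite ?mulr1 ?mulr0.
  by apply: eq_bigr => i _; rewrite !mxE eqxx /=; case: eqP; rewrite ?mulr1 ?mulr0.
have vg j i : v j 0 (g i) = - u j i.
  rewrite vE gh sub0r (bigD1 i) //= eqxx big1 ?addr0 // => l /negPf li.
  by rewrite (inj_eq g_inj) eq_sym li.
have vh i j : v j 0 (h i) = if i == j then d else 0.
  rewrite vE (inj_eq enum_val_inj) big1 ?subr0 // => l _.
  by rewrite eq_sym gh.
have coordP c : (exists i, c = g i) \/ (exists j, c = h j).
  case: (boolP (c \in F)) => [cF|].
    by right; exists (enum_rank_in cF c); rewrite /h enum_rankK_in.
  by rewrite inE negbK => /imsetP[i _ ->]; left; exists i.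
have sumE (G : 'I_N -> int) : \sum_c G c = \sum_i G (g i) + \sum_j G (h j).
  rewrite (bigID (mem [set g i | i : 'I_r])) /= big_imset /=; last by move=> ? ? _ _ /g_inj.
  by congr (_ + _); rewrite -big_enum_val; apply: eq_bigl => c; rewrite /F inE.
(* The column brought in lies outside the image of [g], so the selected columns stay distinct. *)
have minor_le j i : (`|u j i| <= D ^ r)%N.
  rewrite /u cramer_minor; apply: abs_minor_le => // a b.
  case: eqP => [->|_]; case: eqP => [->|_] // /eqP; rewrite ?gh //.
    by rewrite eq_sym gh.
  by move/eqP/g_inj.
have v_le j c : (`|v j 0%R c| <= D ^ r)%N.
  have [[i ->]|[i ->]] := coordP c; first by rewrite vg abszN.
  rewrite vh; case: eqP => // _; exact: abs_minor_le.
(* By [piv] only the pivot rows need checking, where the claim is [B * adj B = d]. *)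
have kerv j : A *m (v j)^T = 0.
  apply: piv => l; rewrite mxE sumE.
  rewrite [X in _ + X](bigD1 j) //= [X in _ + (_ + X)]big1 ?addr0; last first.
    by move=> i /negPf ij; rewrite mxE vh ij mulr0.
  rewrite mxE vh eqxx; apply/eqP; rewrite addrC addr_eq0; apply/eqP.
  have := congr1 (fun M : 'cV[int]_r => M l 0)
    (mulmxA (mxsub f g A) (\adj (mxsub f g A)) (\col_l A (f l) (h j))).
  rewrite mul_mx_adj mul_scalar_mx [in RHS]mxE [X in _ = _ * X]mxE mulrC -/d => <-.
  by rewrite mxE -sumrN; apply: eq_bigr => i _; rewrite [(v j)^T _ _]mxE vg mulrN opprK mxE.
have v_span x : A *m x^T = 0 -> d *: x = \sum_j x 0 (h j) *: v j.
  move=> Ax; have Bx : mxsub f g A *m (\col_i x 0 (g i)) =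
      - \sum_j x 0 (h j) *: \col_l A (f l) (h j).
    apply/colP => l; have /colP/(_ (f l)) := Ax.
    rewrite mxE sumE [RHS]mxE => /eqP; rewrite addr_eq0 => /eqP E.
    rewrite !mxE; have -> : \sum_i mxsub f g A l i * (\col_i x 0 (g i)) i 0
        = \sum_i A (f l) (g i) * x^T (g i) 0.
      by apply: eq_bigr => i _; rewrite !mxE.
    by rewrite E summxE; congr (- _); apply: eq_bigr => j _; rewrite !mxE mulrC.
  have dx : d *: (\col_i x 0 (g i)) =
      - \sum_j x 0 (h j) *: (\adj (mxsub f g A) *m \col_l A (f l) (h j)).
    rewrite -mul_scalar_mx -mul_adj_mx -mulmxA Bx mulmxN mulmx_sumr.
    by congr (- _); apply: eq_bigr => j _; rewrite -scalemxAr.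
  apply/rowP => c; rewrite summxE; have [[i ->]|[i ->]] := coordP c.
    have /colP/(_ i) := dx; rewrite !mxE summxE => ->; rewrite -sumrN.
    by apply: eq_bigr => j _; rewrite [in LHS]mxE [in RHS]mxE vg mulrN.
  rewrite (bigD1 i) //= big1 ?addr0 => [|j /negPf ji].
    by rewrite [in LHS]mxE [in RHS]mxE vh eqxx mulrC.
  by rewrite mxE vh eq_sym ji mulr0.
have K0 : A *m (0 : 'rV_N)^T = 0 by rewrite trmx0 mulmx0.
have KB (x y : 'rV_N) : A *m x^T = 0 -> A *m y^T = 0 -> A *m (x - y)^T = 0.
  by move=> hx hy; rewrite linearB /= mulmxBr hx hy subr0.
have [B [PB genB indB leB]] := ex_small_basis K0 KB d_neq0 kerv vh v_span v_le.
exists #|F|, B; split=> //; first by rewrite -[leqRHS]cardF leq_addl.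
move=> i c; apply: leq_trans (leB i c) _.
(* The rank saves a factor [D ^ k], with [k = N - r], which absorbs the factor [k] of the
   reduction. *)
rewrite -[in leqRHS]cardF expnD mulnC leq_mul2l ltnW ?orbT //.
exact: ltn_expl.
Qed.

(** * Elementary symmetric sums over the stars *)

(** Elementary symmetric polynomials over an unordered index set, so that the bijections of stars
    given by the connection act directly. *)
Definition elsym (R : pzSemiRingType) (I : finType) (A : {set I}) (y : I -> R)
    (i : nat) : R :=
  \sum_(S : {set I} | (S \subset A) && (#|S| == i)) \prod_(e in S) y e.

Lemma elsym_imset (R : comNzRingType) (I J : finType) (A : {set I}) (h : I -> J)
    (y : J -> R) i :
  {in A &, injective h} -> elsym (h @: A) y i = elsym A (fun e => y (h e)) i.
Proof.
move=> h_inj; rewrite /elsym.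
rewrite (reindex_onto (fun S : {set I} => h @: S) (fun T => A :&: h @^-1: T)) /=; last first.
  move=> T /andP[/subsetP TA _]; apply/setP => z; apply/imsetP/idP.
    by case=> x; rewrite !inE => /andP[_ hxT] ->.
  by move=> zT; have /imsetP[x xA zx] := TA z zT; exists x; rewrite // !inE xA -zx.
have inAE (S : {set I}) : S \subset A -> (A :&: h @^-1: (h @: S)) = S.
  move=> /subsetP SA; apply/setP => x; rewrite !inE; apply/andP/idP.
    by case=> xA /imsetP[z zS /h_inj ->] //; exact: SA.
  by move=> xS; rewrite SA // imset_f.
have injS (S : {set I}) : S \subset A -> {in S &, injective h}.
  by move=> /subsetP SA a b aS bS; apply: h_inj; exact: SA.
apply: eq_big => [S|S /andP[_ /eqP SA]].
  case SA: (S \subset A); last first.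
    apply/negP => /andP[_ /eqP E]; case/negP: SA.
    by rewrite -E subsetIl.
  by rewrite imsetS // card_in_imset ?inAE ?eqxx ?andbT //; exact: injS.
by rewrite big_imset //; apply: injS; rewrite -SA subsetIl.
Qed.

(** A single induction for every relation compatible with the ring operations: graphs of morphisms,
    equality, congruences. *)
Lemma elsym_rel (R S : pzSemiRingType) (rel : R -> S -> Prop) (I : finType)
    (A : {set I}) (y : I -> R) (z : I -> S) i :
  rel 0 0 -> rel 1 1 ->
  (forall a b a' b', rel a b -> rel a' b' -> rel (a + a') (b + b')) ->
  (forall a b a' b', rel a b -> rel a' b' -> rel (a * a') (b * b')) ->
  {in A, forall e, rel (y e) (z e)} -> rel (elsym A y i) (elsym A z i).
Proof.
move=> r0 r1 rD rM ryz; apply: big_ind2 => // T /andP[/subsetP TA _].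
by apply: big_ind2 => // e /TA; apply: ryz.
Qed.

Lemma elsym_scale (R : comNzRingType) (I : finType) (A : {set I}) (y : I -> R) a i :
  elsym A (fun e => a * y e) i = a ^+ i * elsym A y i.
Proof.
rewrite /elsym mulr_sumr; apply: eq_bigr => T /andP[_ /eqP <-].
by rewrite big_split prodr_const.
Qed.

Lemma mesym_elsym (R : comNzRingType) (I : finType) (A : {set I}) (y : I -> R) i :
  (mesym #|A| R i).@[fun j => y (enum_val j)] = elsym A y i.
Proof.
rewrite /mesym raddf_sum /=.
have -> : elsym A y i = elsym [set: 'I_#|A|] (fun j => y (enum_val j)) i.
  rewrite -(@elsym_imset _ _ _ _ (@enum_val I (mem A))); last by move=> a b _ _ /enum_val_inj.
  congr elsym; apply/setP => x; apply/idP/imsetP => [xA|[j _ ->]]; last exact: enum_valP.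
  by exists (enum_rank_in xA x); rewrite ?enum_rankK_in.
apply: eq_big => [S|S _]; first by rewrite subsetT.
by rewrite rmorph_prod; apply: eq_bigr => j _ /=; rewrite mevalXU.
Qed.

Lemma elsym_norm_le (R : numDomainType) (I : finType) (A : {set I}) (y : I -> R) b i :
  {in A, forall e, `|y e| <= b} -> `|elsym A y i| <= ('C(#|A|, i))%:R * b ^+ i.
Proof.
move=> yb; apply: le_trans (ler_norm_sum _ _ _) _.
rewrite -cards_draws -sum1_card natr_sum mulr_suml.
under [leRHS]eq_bigl do rewrite inE.
apply: ler_sum => S /andP[/subsetP SA /eqP <-]; rewrite mul1r normr_prod -prodr_const.
by apply: ler_prod => e eS; rewrite normr_ge0 yb // SA.
Qed.

Section Numerator.

Variables (V : finType) (G : graph V).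

Definition chern_term (R : pzSemiRingType) (s : seq nat) (y : edges G -> R) v : R :=
  \prod_(i <- s) elsym (star G v) y i.

(** The numerator of [loc] over the common denominator [\prod_e y e], where each edge occurs in both
    directions. *)
Definition numer (R : pzSemiRingType) (s : seq nat) (y : edges G -> R) : R :=
  \sum_v chern_term s y v * \prod_(e | e \notin star G v) y e.

Definition loc (F : fieldType) (s : seq nat) (y : edges G -> F) : F :=
  \sum_v chern_term s y v / \prod_(e in star G v) y e.

Lemma locE (F : fieldType) s (y : edges G -> F) :
  (forall e, y e != 0) -> loc s y = numer s y / \prod_e y e.
Proof.
move=> y_neq0; rewrite /loc /numer mulr_suml; apply: eq_bigr => v _.
rewrite -mulrA; congr (_ * _).
rewrite [X in _ / X](bigID (mem (star G v))) /= invfM mulrCA mulfV ?mulr1 //.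
by apply/prodf_neq0 => e _.
Qed.

Lemma chern_term_rel (R S : pzSemiRingType) (rel : R -> S -> Prop) s
    (y : edges G -> R) (z : edges G -> S) v :
  rel 0 0 -> rel 1 1 ->
  (forall a b a' b', rel a b -> rel a' b' -> rel (a + a') (b + b')) ->
  (forall a b a' b', rel a b -> rel a' b' -> rel (a * a') (b * b')) ->
  {in star G v, forall e, rel (y e) (z e)} ->
  rel (chern_term s y v) (chern_term s z v).
Proof.
move=> r0 r1 rD rM ryz; apply: (big_ind2 rel) => // i _.
exact: (elsym_rel i r0 r1 rD rM ryz).
Qed.

Lemma numer_rel (R S : pzSemiRingType) (rel : R -> S -> Prop) s
    (y : edges G -> R) (z : edges G -> S) :
  rel 0 0 -> rel 1 1 ->
  (forall a b a' b', rel a b -> rel a' b' -> rel (a + a') (b + b')) ->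
  (forall a b a' b', rel a b -> rel a' b' -> rel (a * a') (b * b')) ->
  (forall e, rel (y e) (z e)) -> rel (numer s y) (numer s z).
Proof.
move=> r0 r1 rD rM ryz; apply: (big_ind2 rel) => // v _; apply: (rM).
  by apply: (chern_term_rel s r0 r1 rD rM) => e _; apply: ryz.
by apply: (big_ind2 rel).
Qed.

Lemma numer_rmorph (R S : pzSemiRingType) (f : {rmorphism R -> S}) s (y : edges G -> R) :
  f (numer s y) = numer s (fun e => f (y e)).
Proof.
apply: (@numer_rel _ _ (fun a b => f a = b)); rewrite ?rmorph0 ?rmorph1 //.
  by move=> a _ a' _ <- <-; rewrite rmorphD.
by move=> a _ a' _ <- <-; rewrite rmorphM.
Qed.

Lemma eq_numer (R : pzSemiRingType) s (y z : edges G -> R) :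
  y =1 z -> numer s y = numer s z.
Proof. by move=> yz; apply: (@numer_rel _ _ eq) => // a b a' b' -> ->. Qed.

Lemma chern_term_scale (R : comNzRingType) s (y : edges G -> R) a v :
  chern_term s (fun e => a * y e) v = a ^+ sumn s * chern_term s y v.
Proof.
elim: s => [|i s IH]; first by rewrite /chern_term !big_nil mulr1.
rewrite /chern_term !big_cons -!/(chern_term _ _ _) IH elsym_scale /= exprD; ring.
Qed.

(** Each summand is homogeneous: degree [sumn s] from the star, plus one for each edge outside
    it. *)
Lemma numer_scale (R : comNzRingType) s (y : edges G -> R) a :
  (forall v, #|star G v| = sumn s) ->
  numer s (fun e => a * y e) = a ^+ #|{: edges G}| * numer s y.
Proof.
move=> hs; rewrite /numer mulr_sumr; apply: eq_bigr => v _.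
rewrite chern_term_scale big_split /= prodr_const.
have -> : #|[pred e | e \notin star G v]| = #|~: star G v|.
  by apply: eq_card => e; rewrite !inE.
rewrite -(cardsC (star G v)) hs exprD; ring.
Qed.

End Numerator.

(** * Cancellation of simple poles *)

Section Connection.

Variables (V : finType) (G : graph V) (nabla : edges G -> edges G -> edges G).
Hypothesis nablaP : connection nabla.

Lemma erevK : involutive (@erev V G).
Proof. by move=> e; apply: val_inj; case: e => -[]. Qed.

Lemma mem_star_src (e : edges G) : e \in star G (src e).
Proof. by rewrite inE. Qed.

Lemma nabla_inj e : {in star G (src e) &, injective (nabla e)}.
Proof. by case: nablaP => _ nablaK _ f g fs gs E; rewrite -(nablaK e f) // E nablaK. Qed.

Lemma star_dst e : star G (dst e) = nabla e @: star G (src e).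
Proof.
case: nablaP => nabla_in nablaK _; apply/setP => f; apply/idP/imsetP.
  move=> fs; exists (nabla (erev e) f); first exact: (nabla_in (erev e)).
  by rewrite -[in nabla e](erevK e) (nablaK (erev e)).
by case=> g gs ->; apply: nabla_in.
Qed.

End Connection.

(** Used for the local rings [regular x], where membership means having no pole at [x]. *)
Definition subring (R : pzRingType) (O : R -> Prop) : Prop :=
  [/\ O 1, forall x y, O x -> O y -> O (x - y)
    & forall x y, O x -> O y -> O (x * y)].

Section SubringTheory.

Variables (F : fieldType) (O : F -> Prop).
Hypothesis subO : subring O.

Let O1 : O 1. Proof. by case: subO. Qed.
Let OB x y : O x -> O y -> O (x - y). Proof. by case: subO => _ + _; apply. Qed.
Let OM x y : O x -> O y -> O (x * y). Proof. by case: subO => _ _; apply. Qed.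

Lemma subring0 : O 0. Proof. by rewrite -(subrr 1); apply: OB. Qed.

Lemma subringN x : O x -> O (- x).
Proof. by move=> Ox; rewrite -sub0r; apply: OB => //; apply: subring0. Qed.

Lemma subringD x y : O x -> O y -> O (x + y).
Proof. by move=> Ox Oy; rewrite -[y]opprK; apply: OB => //; apply: subringN. Qed.

Lemma subring_sum (I : Type) (r : seq I) (P : pred I) (f : I -> F) :
  (forall i, P i -> O (f i)) -> O (\sum_(i <- r | P i) f i).
Proof.
move=> Of; apply: big_ind => //; first exact: subring0.
by move=> x y; apply: subringD.
Qed.

Lemma subring_prod (I : Type) (r : seq I) (P : pred I) (f : I -> F) :
  (forall i, P i -> O (f i)) -> O (\prod_(i <- r | P i) f i).
Proof. by move=> Of; apply: big_ind => // x y; apply: OM. Qed.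

Lemma subringX x n : O x -> O (x ^+ n).
Proof. by move=> Ox; elim: n => [|n IH]; rewrite ?expr0 // exprS; apply: OM. Qed.

Definition congr_mod (y a b : F) : Prop :=
  [/\ O a, O b & exists2 c, O c & a - b = c * y].

Variable y : F.

Lemma congr_modxx a : O a -> congr_mod y a a.
Proof. by move=> Oa; split=> //; exists 0; [exact: subring0|rewrite subrr mul0r]. Qed.

Lemma congr_modD a b a' b' :
  congr_mod y a b -> congr_mod y a' b' -> congr_mod y (a + a') (b + b').
Proof.
move=> [Oa Ob [c Oc E]] [Oa' Ob' [c' Oc' E']]; split; try exact: subringD.
by exists (c + c'); [exact: subringD|rewrite mulrDl -E -E' opprD addrACA].
Qed.

Lemma congr_modM a b a' b' :
  congr_mod y a b -> congr_mod y a' b' -> congr_mod y (a * a') (b * b').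
Proof.
move=> [Oa Ob [c Oc E]] [Oa' Ob' [c' Oc' E']]; split; try exact: OM.
exists (c * a' + b * c'); first by apply: subringD; apply: OM.
by rewrite mulrDl -mulrA [a' * y]mulrC mulrA -E -mulrA -E'; ring.
Qed.

Lemma congr_modV a b : a != 0 -> b != 0 -> O a^-1 -> O b^-1 ->
  congr_mod y a b -> congr_mod y a^-1 b^-1.
Proof.
move=> a0 b0 Oa Ob [_ _ [c Oc E]]; split=> //.
exists (- c * a^-1 * b^-1); first by do 2![apply: OM => //]; apply: subringN.
have -> : - c * a^-1 * b^-1 * y = - (c * y) * (a^-1 * b^-1) by ring.
by rewrite -E; field; rewrite a0 b0.
Qed.

End SubringTheory.

Section Localization.

Variables (V : finType) (G : graph V) (nabla : edges G -> edges G -> edges G).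
Hypothesis nablaP : connection nabla.
Variables (F : fieldType) (O : F -> Prop) (y : edges G -> F) (bad : pred (edges G)).
Hypothesis subO : subring O.
Hypothesis two_neq0 : 2 != 0 :> F.
Hypothesis O_half : O 2^-1.
Hypothesis y_neq0 : forall e, y e != 0.
Hypothesis Oy : forall e, O (y e).
Hypothesis bad_erev : forall e, bad (erev e) = bad e.
Hypothesis bad_uniq : forall v, {in star G v &, forall e f, bad e -> bad f -> e = f}.
Hypothesis good_unit : forall e, ~~ bad e -> O (y e)^-1.
Hypothesis y_erev : forall e, O ((y e)^-1 + (y (erev e))^-1).
Hypothesis y_nabla : forall e, {in star G (src e), forall f,
  exists2 c, O c & y f - y (nabla e f) = c * y e}.

Let term s v := chern_term s y v / \prod_(e in star G v) y e.
(** The term at [src e] without its factor [(y e)^-1], the only possible pole when [e] is bad. *)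
Let cofactor s (e : edges G) :=
  chern_term s y (src e) * \prod_(f in star G (src e) :\ e) (y f)^-1.

Lemma term_cofactor s e : term s (src e) = cofactor s e * (y e)^-1.
Proof.
rewrite /term /cofactor (big_setD1 e) ?mem_star_src //= invfM -prodfV.
by rewrite mulrCA mulrA [RHS]mulrC mulrA.
Qed.

Lemma bad_star e f : bad e -> f \in star G (src e) :\ e -> ~~ bad f.
Proof.
move=> be; rewrite in_setD1 => /andP[fe fs]; apply: contra fe => bf.
by apply/eqP; apply: (bad_uniq fs (mem_star_src e)).
Qed.

(** The map [nabla e] matches the two stars, sends [e] to [erev e] and preserves labels modulo
    [y e]. The other edges are good, so their inverses are congruent as well. *)
Lemma cofactor_congr s e : bad e ->
  congr_mod O (y e) (cofactor s e) (cofactor s (erev e)).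
Proof.
move=> be; have [nabla_in nablaK nablae] := nablaP.
have O1 : O 1 by case: subO.
have y_congr f : f \in star G (src e) -> congr_mod O (y e) (y f) (y (nabla e f)).
  by move=> fs; split=> //; apply: y_nabla.
have congr00 := congr_modxx subO (y e) (subring0 subO).
have congr11 := congr_modxx subO (y e) O1.
apply: congr_modM => //.
  have -> : chern_term s y (src (erev e)) = chern_term s (fun f => y (nabla e f)) (src e).
    apply: eq_bigr => i _; rewrite -(elsym_imset y i (nabla_inj nablaP (e := e))).
    by rewrite -star_dst.
  apply: (chern_term_rel s congr00 congr11) => //; first exact: congr_modD.
  exact: congr_modM.
have -> : star G (src (erev e)) :\ erev e = nabla e @: (star G (src e) :\ e).
  apply/setP => f; rewrite in_setD1 [_ \in star _ _](_ : _ = (f \in star G (dst e))) //.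
  rewrite (star_dst nablaP); apply/andP/imsetP.
    case=> fe /imsetP[g gs E]; exists g => //; rewrite in_setD1 gs andbT.
    by apply: contraNneq fe => ge; rewrite E ge nablae.
  case=> g; rewrite in_setD1 => /andP[ge gs] ->; split; last exact: imset_f.
  by apply: contraNneq ge; rewrite -nablae => /(nabla_inj nablaP) ->; rewrite ?mem_star_src.
rewrite big_imset /=; last first.
  by move=> f g /setD1P[_ fs] /setD1P[_ gs]; apply: nabla_inj.
apply: (big_ind2 (congr_mod O (y e))) => // [a b a' b'|f fs]; first exact: congr_modM.
have /setD1P[fe fsrc] := fs.
apply: congr_modV => //; last exact: y_congr.
  exact/good_unit/bad_star/fs.
apply/good_unit/(bad_star (e := erev e)); first by rewrite bad_erev.
rewrite in_setD1 [_ \in star _ _](_ : _ = (nabla e f \in star G (dst e))) //.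
rewrite nabla_in // andbT -nablae; apply: contra fe => /eqP.
by move/(nabla_inj nablaP) => -> //; rewrite mem_star_src.
Qed.

(** Congruent cofactors reduce the sum of the two terms to an element of [O] plus a multiple of
    [(y e)^-1 + (y (erev e))^-1]. *)
Lemma term_pair s e : bad e -> O (term s (src e) + term s (dst e)).
Proof.
move=> be; have [_ _ OM] := subO.
have [Oa Ob [c Oc E]] := cofactor_congr s be.
rewrite (term_cofactor s e)
  (_ : term s (dst e) = cofactor s (erev e) * (y (erev e))^-1); last first.
  exact: (term_cofactor s (erev e)).
rewrite [X in O X](_ : _ = c + cofactor s (erev e) * ((y e)^-1 + (y (erev e))^-1)).
  by apply: subringD => //; apply: OM.
have -> : c = (cofactor s e - cofactor s (erev e)) / y e by rewrite E mulfK.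
ring.
Qed.

(* Summing the terms at the two ends of each bad edge cancels the simple pole. *)
Lemma loc_subring s : O (loc s y).
Proof.
have [_ _ OM] := subO.
(* The involution that crosses the unique bad edge at [v], or fixes [v] if there is none. *)
pose tau v := if [pick e in star G v | bad e] is Some e then dst e else v.
have tauP v : (tau v = v /\ forall e, e \in star G v -> ~~ bad e) \/
    exists2 e, bad e & v = src e /\ tau v = dst e.
  rewrite /tau; case: pickP => [e /andP[]|noe]; last first.
    by left; split=> // e es; have := noe e; rewrite es => /negbT.
  by rewrite inE => /eqP sv be; right; exists e.
have tau_bad e : bad e -> tau (src e) = dst e.
  move=> be; case: (tauP (src e)) => [[_ /(_ e (mem_star_src e))]|[f bf [E ->]]].
    by rewrite be.
  by congr dst; apply: (bad_uniq (v := src e)); rewrite ?inE ?E.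
have tauK : involutive tau.
  move=> v; case: (tauP v) => [[E _]|[e be [-> ->]]]; first by rewrite !E.
  by rewrite (tau_bad (erev e)) // bad_erev.
(* Averaging over [tau] puts the two ends of each bad edge into one summand. *)
have -> : loc s y = (\sum_v (term s v + term s (tau v))) / 2.
  have E : \sum_v term s v = \sum_v term s (tau v) by exact: reindex_inj (inv_inj tauK).
  rewrite big_split /= -E.
  by rewrite -[X in X / _]mulr2n -[X in X / _]mulr_natr mulfK.
apply: (OM) => //; apply: subring_sum => // v _.
case: (tauP v) => [[E good]|[e be [-> ->]]]; last exact: term_pair.
have Ot : O (term s v).
  apply: (OM); last by rewrite -prodfV; apply: subring_prod => // e /good /good_unit.
  apply: subring_prod => // i _; apply: subring_sum => // S _.
  exact: subring_prod.
by rewrite E; apply: (subringD).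
Qed.

End Localization.

(** The relations of [ext_lattice] with values in any ring, so that integral solutions and the
    linear forms of [alpha] can be compared. *)
Definition axial (V : finType) (G : graph V)
    (nabla : edges G -> edges G -> edges G) (c : edges G -> edges G -> int)
    (R : pzRingType) (l : edges G -> R) : Prop :=
  (forall e, l (erev e) = - l e) /\
  (forall e, {in star G (src e), forall f,
     l f - l (nabla e f) = (c e f)%:~R * l e}).

(** The local ring of the affine line at [x]. *)
Definition regular (F : fieldType) (x : F) (P : {fraction {poly F}}) : Prop :=
  exists2 AB : {poly F} * {poly F}, AB.2.[x] != 0 & P = tofrac AB.1 / tofrac AB.2.

Lemma mulf_divM (F : fieldType) (x a b : F) : x != 0 -> x * (a / (x * b)) = a / b.
Proof. by move=> x0; rewrite mulrA -mulf_div divff // mul1r. Qed.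

Lemma divf_eq_mul (F : fieldType) (a b c d : F) :
  b != 0 -> d != 0 -> a / b = c / d -> a * d = c * b.
Proof. by move=> b0 d0 /eqP; rewrite eqr_div // => /eqP. Qed.

(** * Rational functions of one variable: poles and behaviour at infinity *)

Section Regular.

Variable F : fieldType.
Implicit Types (x : F) (A B N M h : {poly F}).

Lemma horner_tofrac_neq0 x A : A.[x] != 0 -> tofrac A != 0.
Proof. by rewrite tofrac_eq0; apply: contraNneq => ->; rewrite horner0. Qed.

Lemma regular_tofrac x A : regular x (tofrac A).
Proof. by exists (A, 1) => /=; rewrite ?hornerE ?oner_eq0 // tofrac1 divr1. Qed.

Lemma regular_inv x A : A.[x] != 0 -> regular x (tofrac A)^-1.
Proof. by move=> Ax; exists (1, A) => //=; rewrite tofrac1 div1r. Qed.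

Lemma regular_subring x : subring (regular x).
Proof.
split; first by rewrite -tofrac1; apply: regular_tofrac.
  move=> P Q [[A B] /= Bx ->] [[A' B'] /= Bx' ->].
  exists (A * B' - A' * B, B * B') => /=; first by rewrite hornerM mulf_neq0.
  rewrite tofracB !tofracM -[in LHS]mulNr addf_div ?(horner_tofrac_neq0 (x := x)) //.
  by rewrite mulNr.
move=> P Q [[A B] /= Bx ->] [[A' B'] /= Bx' ->].
exists (A * A', B * B') => /=; first by rewrite hornerM mulf_neq0.
by rewrite !tofracM mulf_div.
Qed.

(** Induction on the roots [a] of the denominator: if [h] vanishes at [a], one factor [h] pays for
    it; otherwise regularity at [a] makes [N] vanish there. *)
Lemma dvdp_of_regular_monic h (rs : seq F) N :
  (forall x, h.[x] != 0 ->
     regular x (tofrac N / tofrac (\prod_(a <- rs) ('X - a%:P)))) ->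
  exists j N', h ^+ j * N = (\prod_(a <- rs) ('X - a%:P)) * N'.
Proof.
elim: rs N => [|a rs IH] N; first by exists 0%N, N; rewrite big_nil expr0.
rewrite big_cons; set M := \prod_(_ <- _) _ in IH *.
have M_neq0 : M != 0 by rewrite monic_neq0 // monic_prod_XsubC.
have Xa_neq0 : 'X - a%:P != 0 by rewrite polyXsubC_eq0.
have fM : tofrac M != 0 by rewrite tofrac_eq0.
have fX : tofrac ('X - a%:P) != 0 by rewrite tofrac_eq0.
move=> reg; case: (eqVneq h.[a] 0) => [ha|ha].
  have [h' hE] := factor_theorem h a (introT eqP ha).
  have [|j [N' E]] := IH N.
    move=> x hx; have [_ _ regM] := regular_subring x.
    have -> : tofrac N / tofrac M = tofrac ('X - a%:P) * (tofrac N / tofrac (('X - a%:P) * M)).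
      by rewrite tofracM mulf_divM.
    by apply: regM; [exact: regular_tofrac|exact: reg].
  exists j.+1, (h' * N'); rewrite exprS -mulrA E [in h * _]hE; ring.
have [[A B] /= Ba E] := reg a ha.
have NB : N * B = A * (('X - a%:P) * M).
  have fB := horner_tofrac_neq0 Ba; have fXM : tofrac (('X - a%:P) * M) != 0.
    by rewrite tofrac_eq0 mulf_neq0.
  apply/eqP; rewrite -tofrac_eq tofracM [X in _ == X]tofracM; apply/eqP.
  exact: divf_eq_mul fXM fB E.
have /factor_theorem[N1 NE] : root N a.
  have := congr1 (horner^~ a) NB; rewrite /root !hornerM hornerXsubC subrr.
  by rewrite mul0r mulr0 => /eqP; rewrite mulf_eq0 (negPf Ba) orbF.
have [|j [N' E']] := IH N1.
  move=> x hx; have := reg x hx.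
  by rewrite NE [N1 * _]mulrC !tofracM -mulf_div divff // mul1r.
by exists j, N'; rewrite NE mulrA E'; ring.
Qed.

Lemma dvdp_of_regular h (rs : seq F) k N M : k != 0 ->
  M = k *: \prod_(a <- rs) ('X - a%:P) ->
  (forall x, h.[x] != 0 -> regular x (tofrac N / tofrac M)) ->
  exists j N', h ^+ j * N = M * N'.
Proof.
move=> k0 -> reg; have [|j [N' E]] := @dvdp_of_regular_monic h rs N.
  move=> x hx; have [_ _ regM] := regular_subring x.
  have -> : tofrac N / tofrac (\prod_(a <- rs) ('X - a%:P)) =
     tofrac k%:P * (tofrac N / tofrac (k *: \prod_(a <- rs) ('X - a%:P))).
    by rewrite -mul_polyC tofracM mulf_divM // tofrac_eq0 polyC_eq0.
  by apply: regM; [exact: regular_tofrac|exact: reg].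
exists j, (k^-1 *: N'); rewrite E -scalerAl -scalerAr scalerA mulfV //.
by rewrite scale1r.
Qed.

(** The value at infinity of [p / X^d]; allowing [a = 0] makes it compatible with sums and
    products. *)
Definition top_coef d (p : {poly F}) a := (size p <= d.+1)%N /\ p`_d = a.

Lemma top_coefM d d' p q a b :
  top_coef d p a -> top_coef d' q b -> top_coef (d + d') (p * q) (a * b).
Proof.
move=> [sp <-] [sq <-]; split.
  by apply: leq_trans (size_polyMleq _ _) _; lia.
have lt_d : (d < (d + d').+1)%N by lia.
rewrite coefM (bigD1 (Ordinal lt_d)) //= big1 ?addr0 => [|i id]; first by rewrite addKn.
case: (ltngtP i d) => [lt|gt|E]; last by case/eqP: id; apply: val_inj.
  by rewrite [X in _ * X]nth_default ?mulr0 //; apply: leq_trans sq _; lia.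
by rewrite nth_default ?mul0r //; apply: leq_trans sp _; lia.
Qed.

Lemma top_coef_sum d (I : Type) (r : seq I) (P : pred I) (p : I -> {poly F}) a :
  (forall i, P i -> top_coef d (p i) (a i)) ->
  top_coef d (\sum_(i <- r | P i) p i) (\sum_(i <- r | P i) a i).
Proof.
move=> H; apply: (big_ind2 (top_coef d)) => //; first by rewrite /top_coef size_poly0 coef0.
move=> x a1 y b [sx <-] [sy <-]; rewrite /top_coef coefD; split=> //.
by apply: leq_trans (size_polyD _ _) _; rewrite geq_max sx.
Qed.

Lemma top_coef_prod (I : Type) (r : seq I) (P : pred I) (d : I -> nat) (p : I -> {poly F}) a :
  (forall i, P i -> top_coef (d i) (p i) (a i)) ->
  top_coef (\sum_(i <- r | P i) d i) (\prod_(i <- r | P i) p i) (\prod_(i <- r | P i) a i).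
Proof.
move=> H; elim: r => [|i r IH].
  by rewrite !big_nil /top_coef size_poly1 coef1.
by rewrite !big_cons; case: ifP => // Pi; apply: top_coefM => //; apply: H.
Qed.

End Regular.

(** * Independence of the localization sum from the axial labelling *)

Section Deformation.

Variables (V : finType) (G : graph V) (nabla : edges G -> edges G -> edges G).
Variable c : edges G -> edges G -> int.
Hypothesis nablaP : connection nabla.
Variable s : seq nat.
Hypothesis card_star : forall v, #|star G v| = sumn s.

Lemma numer_top_coef (F : fieldType) (y : edges G -> {poly F}) (a : edges G -> F) :
  (forall e, top_coef 1 (y e) (a e)) ->
  top_coef #|{: edges G}| (numer s y) (numer s a).
Proof.
move=> ya; apply: top_coef_sum => v _.
have -> : #|{: edges G}| = (\sum_(i <- s) i + \sum_(e | e \notin star G v) 1)%N.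
  by rewrite -sumnE -(card_star v) sum1dep_card -(cardsC (star G v)).
apply: top_coefM; last by apply: top_coef_prod.
apply: top_coef_prod => i _; apply: top_coef_sum => S /andP[_ /eqP <-].
by rewrite -sum1_card; apply: top_coef_prod.
Qed.

(* [loc (l + t m)] has no pole in [t], infinity included, so it does not depend
   on [t]. *)
Lemma loc_axial_eq (F : fieldType) (l m : edges G -> F) :
  2 != 0 :> F -> axial nabla c l -> axial nabla c m ->
  (forall e, l e != 0) -> (forall e, m e != 0) ->
  (forall v, {in star G v &, forall e f, e != f -> l e * m f != l f * m e}) ->
  loc s l = loc s m.
Proof.
move=> two_neq0 [l_erev l_nabla] [m_erev m_nabla] l0 m0 lm.
pose Y e := (l e)%:P + m e *: 'X.
have Y_horner e x : (Y e).[x] = l e + m e * x by rewrite !hornerE.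
have YE e : Y e = m e *: ('X - (- l e / m e)%:P).
  rewrite scalerBr -mul_polyC -[X in _ - X]mul_polyC -polyCM.
  by rewrite mulrCA mulfV // mulr1 polyCN opprK addrC mul_polyC.
have Y_neq0 e : Y e != 0 by rewrite YE scaler_eq0 negb_or m0 polyXsubC_eq0.
have fY_neq0 e : tofrac (Y e) != 0 by rewrite tofrac_eq0.
have Y_erev e : Y (erev e) = - Y e.
  by rewrite /Y l_erev m_erev polyCN scaleNr opprD.
have Y_nabla e : {in star G (src e), forall f, Y f - Y (nabla e f) = (c e f)%:~R * Y e}.
  move=> f fs; rewrite /Y opprD addrACA -polyCB -scalerBl l_nabla // m_nabla //.
  by rewrite mulrDr polyCM rmorph_int -scalerA !mulrzl scaler_int.
have reg x : regular x (tofrac (numer s Y) / tofrac (\prod_e Y e)).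
  have subO := regular_subring x.
  have -> : tofrac (numer s Y) / tofrac (\prod_e Y e) = loc s (fun e => tofrac (Y e)).
    by rewrite locE // -numer_rmorph rmorph_prod.
  apply: (loc_subring nablaP (bad := fun e => (Y e).[x] == 0)) => //.
  - by rewrite -(rmorph_nat (@tofrac {poly F})) tofrac_eq0 -polyC_natr polyC_eq0.
  - rewrite -(rmorph_nat (@tofrac {poly F})); apply: regular_inv.
    by rewrite -polyC_natr hornerC.
  - by move=> e; apply: regular_tofrac.
  - by move=> e; rewrite Y_erev hornerN oppr_eq0.
  (* A common zero of two pencil labels at one vertex contradicts the transversality [lm]. *)
  - move=> v e f es fs; rewrite !Y_horner => /eqP E /eqP E'.
    apply/eqP; apply: contraT => /(lm v e f es fs) /eqP[].
    by rewrite -[l e]opprK -[l f]opprK (addr0_eq E) (addr0_eq E'); ring.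
  - by move=> e; apply: regular_inv.
  - by move=> e; rewrite Y_erev tofracN invrN subrr; apply: subring0.
  - move=> e f fs; exists (tofrac (c e f)%:~R); first exact: regular_tofrac.
    by rewrite -tofracB Y_nabla // tofracM.
(* The denominator splits over [F], so regularity at the points of [F] suffices for divisibility. *)
pose roots := [seq - l e / m e | e <- enum {: edges G}].
have prodY : \prod_e Y e = (\prod_e m e) *: \prod_(a <- roots) ('X - a%:P).
  rewrite big_map big_enum /= -mul_polyC rmorph_prod /= -big_split /=.
  by apply: eq_bigr => e _; rewrite YE mul_polyC.
have m_neq0 : \prod_e m e != 0 by apply/prodf_neq0.
have [j [N']] := dvdp_of_regular (h := 1) m_neq0 prodY (fun x _ => reg x).
rewrite expr1n mul1r => E.
have [numer_size numer_coef] : top_coef #|{: edges G}| (numer s Y) (numer s m).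
  apply: numer_top_coef => e; split; last by rewrite coefD coefC coefZ coefX mulr1 add0r.
  by rewrite YE size_scale // size_XsubC.
have prodY_neq0 : \prod_e Y e != 0 by apply/prodf_neq0.
have prodY_size : size (\prod_e Y e) = #|{: edges G}|.+1.
  by rewrite prodY size_scale // size_prod_XsubC size_map -cardE.
(* Numerator and denominator both have degree at most [|E|], the latter exactly, so the quotient is
   constant. *)
have N'_size : (size N' <= 1)%N.
  case: (eqVneq N' 0) => [->|N'0]; first by rewrite size_poly0.
  by move: numer_size; rewrite E size_mul // prodY_size addSn /= -[leqRHS]addn1 leq_add2l.
have [k kE] : exists k, N' = k%:P by exists N'`_0; apply: size1_polyC.
(* The constant is read off at [t = 0] for [l], then from the top coefficients for [m]. *)
have kl : numer s l = k * \prod_e l e.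
  have := congr1 (horner^~ 0) E; rewrite kE hornerM hornerC horner_prod mulrC.
  under eq_bigr do rewrite Y_horner mulr0 addr0.
  move=> <-; rewrite -[(numer s Y).[0]]/(horner_eval 0 (numer s Y)) numer_rmorph.
  by apply: eq_numer => e; rewrite /= horner_evalE Y_horner mulr0 addr0.
have km : numer s m = k * \prod_e m e.
  rewrite -numer_coef E kE mulrC mul_polyC coefZ prodY coefZ; congr (_ * _).
  rewrite -[RHS]mulr1; congr (_ * _).
  have /monicP := monic_prod_XsubC roots predT id; rewrite /lead_coef size_prod_XsubC.
  by rewrite size_map -cardE.
rewrite !locE // kl km !mulfK //; exact/prodf_neq0.
Qed.

End Deformation.

(** * Integrality *)

(** A geometric sum, with [1 - w^-n = - w^-n * (1 - w^n)] for negative exponents. This turns the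
    line Chern number relations into congruences modulo [1 - w]. *)
Lemma exprz_sub1_subring (F : fieldType) (O : F -> Prop) (w : F) (c : int) :
  subring O -> w != 0 -> O w -> O w^-1 ->
  exists2 a, O a & 1 - w ^ c = a * (1 - w).
Proof.
move=> subO w0 Ow Ow'; have [_ _ OM] := subO.
have nonneg n : exists2 a, O a & 1 - w ^+ n = a * (1 - w).
  elim: n => [|n [a Oa E]]; first by exists 0; [exact: subring0|rewrite expr0 subrr mul0r].
  exists (a + w ^+ n); first by apply: subringD => //; apply: subringX.
  by rewrite mulrDl -E exprSr; ring.
case: c => n; first exact: nonneg.
have [a Oa E] := nonneg n.+1.
exists (- (w^-1 ^+ n.+1) * a).
  by apply: OM => //; apply: subringN => //; apply: subringX.
rewrite NegzE -exprnN -mulrA -E exprVn mulrBr mulr1 mulNr mulVf ?expf_neq0 //.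
ring.
Qed.

Lemma expn_mod_sq (m : int) n : exists t, (1 + m) ^+ n = 1 + m * (n%:Z + m * t).
Proof.
elim: n => [|n [t E]]; first by exists 0; rewrite expr0; ring.
by exists (n%:Z + t + m * t); rewrite exprS E intS; ring.
Qed.

Section Integrality.

Variables (V : finType) (G : graph V) (nabla : edges G -> edges G -> edges G).
Variable c : edges G -> edges G -> int.
Hypothesis nablaP : connection nabla.
Variable s : seq nat.
Hypothesis card_star : forall v, #|star G v| = sumn s.
Variables l m : edges G -> int.
Hypothesis l_axial : axial nabla c l.
Hypothesis m_axial : axial nabla c m.
Hypothesis l_neq0 : forall e, l e != 0.
Hypothesis m_neq0 : forall e, m e != 0.
Hypothesis lm_neq : forall v, {in star G v &, forall e f, e != f -> l e * m f != l f * m e}.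
Variable q : nat.
Hypothesis q_gt1 : (1 < q)%N.

(** A common shift making all exponents [l e + J] and [m e + J] nonnegative. *)
Let J : nat := (\sum_e (`|l e| + `|m e|))%N.

Let J_ge e : (`|l e| <= J)%N /\ (`|m e| <= J)%N.
Proof. by rewrite /J (bigD1 e) //=; lia. Qed.

Let lJ e : nat := absz (l e + J%:Z).
Let mJ e : nat := absz (m e + J%:Z).
Let lJE e : (lJ e)%:Z = l e + J%:Z.
Proof. by have [+ _] := J_ge e; rewrite /lJ; lia. Qed.
Let mJE e : (mJ e)%:Z = m e + J%:Z.
Proof. by have [_ +] := J_ge e; rewrite /mJ; lia. Qed.

(* [(q X)^J (1 - q^(l e) X^(m e))]: the K-theoretic Euler class of the edge [e],
   specialised to the two-parameter subgroup [(l, m)] and cleared of negative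
   exponents. *)
Definition euler_poly e : {poly int} :=
  (q%:Z ^+ J) *: 'X^J - (q%:Z ^+ lJ e) *: 'X^(mJ e).

(** Over [algC] the product of these polynomials splits, so its poles can be studied point by
    point. *)
Let Y (e : edges G) : {poly algC} := map_poly intr (euler_poly e).

Let YE e : Y e = (q%:R ^+ J) *: 'X^J - (q%:R ^+ lJ e) *: 'X^(mJ e).
Proof. by rewrite /Y /euler_poly rmorphB /= !map_polyZ /= !map_polyXn !rmorphXn. Qed.

(** As [m e != 0], the two monomials have distinct degrees. Hence the content divides a power of
    [q]. *)
Lemma euler_poly_coef e : (euler_poly e)`_J = q%:Z ^+ J.
Proof.
rewrite coefB !coefZ !coefXn eqxx mulr1.
have -> : (J == mJ e) = false.
  apply/negP => /eqP E; have := mJE e; rewrite -E => /eqP.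
  by rewrite -subr_eq subrr eq_sym (negPf (m_neq0 e)).
by rewrite mulr0 subr0.
Qed.

Let qC_neq0 : q%:R != 0 :> algC.
Proof. by rewrite pnatr_eq0; lia. Qed.

Lemma euler_poly_neq0 e : euler_poly e != 0.
Proof.
apply/eqP => /(congr1 (fun p : {poly int} => p`_J)).
by rewrite euler_poly_coef coef0 => /eqP; rewrite expf_eq0; lia.
Qed.

Let w (F : fieldType) (a b : F) e : F := a ^ l e * b ^ m e.

Let w_factor (F : fieldType) (a b : F) e : a != 0 -> b != 0 ->
  a ^+ J * b ^+ J - a ^+ lJ e * b ^+ mJ e = (a * b) ^+ J * (1 - w a b e).
Proof.
move=> a0 b0; have -> : a ^+ lJ e = a ^ l e * a ^+ J.
  by rewrite [in LHS]exprnP lJE expfzDr // -exprnP.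
have -> : b ^+ mJ e = b ^ m e * b ^+ J by rewrite [in LHS]exprnP mJE expfzDr // -exprnP.
by rewrite /w exprMn; ring.
Qed.

Let Y_horner e x : x != 0 -> (Y e).[x] = (q%:R * x) ^+ J * (1 - w q%:R x e).
Proof. by move=> x0; rewrite YE !hornerE w_factor. Qed.

Let pow_inj (k : int) : q%:R ^ k = 1 :> algC -> k = 0.
Proof.
have nonneg n : q%:R ^+ n = 1 :> algC -> n = 0%N.
  by rewrite -natrX => /eqP; rewrite pnatr_eq1 -(expn0 q) eqn_exp2l // => /eqP.
case: k => n; first by move/nonneg => ->.
by rewrite NegzE -exprnN => /(congr1 GRing.inv); rewrite invrK invr1 => /nonneg.
Qed.

(** Eliminating [x] from the two equations leaves [q ^ (l e * m f - l f * m e) = 1]. Since [q > 1]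
    the exponent is zero, against transversality. *)
Let w_uniq (x : algC) v : x != 0 ->
  {in star G v &, forall e f, w q%:R x e = 1 -> w q%:R x f = 1 -> e = f}.
Proof.
move=> x0 e f es fs we wf; apply/eqP; apply: contraT => /(lm_neq es fs) /eqP[].
apply/eqP; rewrite -subr_eq0; apply/eqP/pow_inj.
have : w q%:R x e ^ m f / w q%:R x f ^ m e = 1 by rewrite we wf !exp1rz divr1.
rewrite /w !expfzMl !exprz_exp [m f * m e]mulrC invfM mulrACA mulfV ?expfz_neq0 //.
by rewrite mulr1 invr_expz -expfzDr.
Qed.

Let w_erev (F : fieldType) (a b : F) e : w a b (erev e) = (w a b e)^-1.
Proof. by rewrite /w l_axial.1 m_axial.1 -!invr_expz -invfM. Qed.

Let w_nabla (F : fieldType) (a b : F) e : a != 0 -> b != 0 ->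
  {in star G (src e), forall f, w a b f = w a b (nabla e f) * w a b e ^ c e f}.
Proof.
move=> a0 b0 f fs; rewrite /w expfzMl !exprz_exp mulrACA -!expfzDr //.
have shift (k : edges G -> int) : axial nabla c k -> k (nabla e f) + k e * c e f = k f.
  by move=> [_ /(_ e f fs)]; rewrite intz [_ * c e f]mulrC => <-; rewrite subrKC.
by rewrite !shift.
Qed.

(** The multiplicative substitute for the cancellation of inverses of opposite labels:
    [1/(1-u) + 1/(1-u^-1) = 1]. *)
Let inv_sub1 (F : fieldType) (k u : F) : u != 0 -> 1 - u != 0 ->
  (k * (1 - u))^-1 + (k * (1 - u^-1))^-1 = k^-1.
Proof.
move=> u0 u1; have -> : 1 - u^-1 = - ((1 - u) / u) by field.
rewrite !invfM -mulrDr -[RHS]mulr1; congr (_ * _).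
by rewrite invrN invfM invrK; field.
Qed.

Let sub_w (F : fieldType) (k a b d g u : F) :
  d = b * g -> 1 - g = a * (1 - u) -> k * (1 - d) - k * (1 - b) = b * a * (k * (1 - u)).
Proof.
move=> -> E; have -> : b * a * (k * (1 - u)) = k * (b * (a * (1 - u))) by ring.
by rewrite -E; ring.
Qed.

Let fY_neq0 e : tofrac (Y e) != 0.
Proof.
rewrite tofrac_eq0 map_poly_eq0_id0 ?euler_poly_neq0 //.
by rewrite intr_eq0 lead_coef_eq0 euler_poly_neq0.
Qed.

Let loc_subring_w (F : fieldType) (O : F -> Prop) (a b : F) (y : edges G -> F)
    (bad : pred (edges G)) :
  subring O -> 2 != 0 :> F -> O 2^-1 -> a != 0 -> b != 0 ->
  O a -> O a^-1 -> O b -> O b^-1 -> (forall e, y e != 0) ->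
  (forall e, y e = (a * b) ^+ J * (1 - w a b e)) ->
  (forall e, bad (erev e) = bad e) ->
  (forall v, {in star G v &, forall e f, bad e -> bad f -> e = f}) ->
  (forall e, ~~ bad e -> O (y e)^-1) -> O (loc s y).
Proof.
move=> subO two0 Ohalf a0 b0 Oa Oa' Ob Ob' y0 yE bad_erev bad_uniq good.
have [O1 OB OM] := subO.
have Oexp u (k : int) : O u -> O u^-1 -> O (u ^ k).
  move=> Ou Ou'; case: k => n; first exact: subringX.
  by rewrite NegzE -exprnN -exprVn; apply: subringX.
have Ow e : O (w a b e) by apply: (OM); apply: Oexp.
have w0 e : w a b e != 0 by rewrite mulf_neq0 // expfz_neq0.
have Ow' e : O (w a b e)^-1 by rewrite -w_erev.
apply: (loc_subring nablaP subO two0 Ohalf y0 _ bad_erev bad_uniq good).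
- move=> e; rewrite yE; apply: (OM); last exact: OB.
  by apply: (subringX subO); apply: OM.
- move=> e; have := y0 e; have := y0 (erev e); rewrite !yE !mulf_eq0 !negb_or.
  move=> /andP[C0 w1'] /andP[_ w1]; rewrite w_erev inv_sub1 //.
  by rewrite -exprVn invfM; apply: (subringX subO); apply: OM.
- move=> e f fs.
  have [d Od E] := exprz_sub1_subring (c e f) subO (w0 e) (Ow e) (Ow' e).
  exists (w a b (nabla e f) * d); first exact: OM.
  by rewrite !yE; apply: sub_w E; apply: w_nabla.
Qed.

(** Apply the cancellation of poles with [a = q] and [b = X]; [X] is a unit of the local ring
    exactly when [x != 0]. *)
Lemma loc_euler_regular x : x != 0 -> regular x (loc s (fun e => tofrac (Y e))).
Proof.
move=> x0; have qx0 : (q%:R * x) ^+ J != 0 by rewrite expf_neq0 // mulf_neq0.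
have badE e : ((Y e).[x] == 0) = (w q%:R x e == 1).
  by rewrite Y_horner // mulf_eq0 (negPf qx0) /= subr_eq0 eq_sym.
have a0 : tofrac (q%:R%:P : {poly algC}) != 0 by rewrite tofrac_eq0 polyC_eq0.
have b0 : tofrac ('X : {poly algC}) != 0 by rewrite tofrac_eq0 polyX_eq0.
apply: (@loc_subring_w _ (regular x) _ _ _ (fun e => (Y e).[x] == 0) _ _ _ a0 b0).
- exact: regular_subring.
- by rewrite -(rmorph_nat (@tofrac {poly algC})) tofrac_eq0 -polyC_natr polyC_eq0 pnatr_eq0.
- rewrite -(rmorph_nat (@tofrac {poly algC})); apply: regular_inv.
  by rewrite -polyC_natr hornerC pnatr_eq0.
- exact: regular_tofrac.
- by apply: regular_inv; rewrite hornerC.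
- exact: regular_tofrac.
- by apply: regular_inv; rewrite hornerX.
- exact: fY_neq0.
- move=> e; rewrite -(w_factor e a0 b0) YE tofracB -!mul_polyC !tofracM.
  by rewrite !polyC_exp !tofracXn.
- by move=> e; rewrite !badE w_erev invr_eq1.
- by move=> v e f es fs; rewrite !badE => /eqP we /eqP wf; apply: (w_uniq x0 es fs).
- by move=> e; apply: regular_inv.
Qed.

(** The sum has poles at most at [X = 0], and powers of [X] disappear at [X = 1]. The power of [q]
    clears the content of the denominator. *)
Lemma euler_dvd : exists r,
  (q%:Z ^+ J) ^+ #|{: edges G}| * numer s (fun e => (euler_poly e).[1]) =
  (\prod_e (euler_poly e).[1]) * r.
Proof.
pose P := \prod_e euler_poly e; pose N := numer s euler_poly.
have mapP : map_poly intr P = \prod_e Y e by rewrite rmorph_prod.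
have mapN : map_poly intr N = numer s Y :> {poly algC} by rewrite numer_rmorph.
have P_neq0 : P != 0 by apply/prodf_neq0 => e _; apply: euler_poly_neq0.
have [j [N']] : exists j N', 'X ^+ j * numer s Y = \prod_e Y e * N'.
  have [rs rsE] := closed_field_poly_normal (\prod_e Y e).
  apply: (dvdp_of_regular _ rsE) => [|x].
    rewrite lead_coef_eq0; apply/prodf_neq0 => e _.
    by have := fY_neq0 e; rewrite tofrac_eq0.
  rewrite hornerX => /loc_euler_regular; rewrite locE; last exact: fY_neq0.
  by rewrite -numer_rmorph -rmorph_prod.
rewrite -mapN -mapP => E.
(* Divisibility descends from [algC] to the rationals; Gauss's lemma then gives an integral quotient
   by the primitive part. *)
have /dvdpP_int[r rE] : P %| 'X^j * N.
  rewrite -dvdp_rat_int -(dvdp_map (ratr : {rmorphism rat -> algC})) -!map_poly_comp.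
  rewrite !(eq_map_poly (g := intr)); try by move=> z; rewrite /= ratr_int.
  by rewrite rmorphM /= map_polyXn E dvdp_mulIl.
have /dvdzP[d dE] : (zcontents P %| (q%:Z ^+ J) ^+ #|{: edges G}|)%Z.
  rewrite -prodr_const (big_morph _ zcontentsM (zcontents_monic (monic1 _))).
  apply: (big_ind2 (fun a b => (a %| b)%Z)) => // [a b a' b'|e _]; first exact: dvdz_mul.
  rewrite -(euler_poly_coef e); have := dvdz_contents (zcontents (euler_poly e)) (euler_poly e).
  by rewrite dvdzz => /esym/polyOverP; apply.
exists (d * r.[1]); rewrite dE.
have -> : numer s (fun e => (euler_poly e).[1]) = N.[1].
  by rewrite -[RHS]/(horner_eval 1 N) numer_rmorph.
have -> : N.[1] = (zprimitive P).[1] * r.[1].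
  by rewrite -hornerM -rE hornerM hornerXn expr1n mul1r.
by rewrite -horner_prod -/P [in RHS](zpolyEprim P) hornerZ; ring.
Qed.

(** Both powers of [1 + a] are expanded modulo [a^2]; the shift [J] cancels in the linear terms. *)
Lemma euler_poly_at1 (a : int) e : q%:Z = 1 + a ->
  exists t, (euler_poly e).[1] = - a * (l e + a * t).
Proof.
move=> qE; have [t tE] := expn_mod_sq a J; have [t' tE'] := expn_mod_sq a (lJ e).
exists (t' - t); rewrite !hornerE ?hornerXn ?expr1n ?mulr1 qE tE tE' lJE; ring.
Qed.

(** Modulo [L], the power of [q] becomes 1, the labels [k e] become [l e], and the right-hand side
    of [euler_dvd] vanishes because [L] divides [\prod_e l e]. *)
Lemma numer_dvd_of_q : q%:Z = 1 + (absz (\prod_e l e))%:Z ->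
  (\prod_e l e %| numer s l)%Z.
Proof.
set L : int := Posz (absz _) => qE.
have L_neq0 : L != 0 by rewrite gt_eqF // /L ltz_nat absz_gt0; apply/prodf_neq0.
have LE : \prod_e l e = sgz (\prod_e l e) * L by rewrite -intEsg.
have [t tE] := fin_all_exists (fun e => euler_poly_at1 e qE).
pose k e := l e + L * t e.
have [r] := euler_dvd.
(* The labels are [- L * k e]; by homogeneity the same power of [- L] occurs on both sides and
   cancels. *)
rewrite (eq_numer s tE) numer_scale // (eq_bigr _ (fun e _ => tE e)) big_split /= prodr_const.
rewrite -/k mulrCA -mulrA => /(mulfI (expf_neq0 _ _)) rE.
have {rE} /rE : - L != 0 by rewrite oppr_eq0.
have rel_add a b a' b' : (exists t, a = b + L * t) -> (exists t, a' = b' + L * t) ->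
    exists t, a + a' = b + b' + L * t.
  by move=> [x ->] [y ->]; exists (x + y); ring.
have rel_mul a b a' b' : (exists t, a = b + L * t) -> (exists t, a' = b' + L * t) ->
    exists t, a * a' = b * b' + L * t.
  by move=> [x ->] [y ->]; exists (x * b' + b * y + L * x * y); ring.
have rel_refl a : exists t, a = a + L * t by exists 0; rewrite mulr0 addr0.
have [x xE] : exists x, numer s k = numer s l + L * x.
  apply: (@numer_rel _ _ _ _ (fun a b => exists t, a = b + L * t)) => // e.
  by exists (t e).
have [y yE] : exists y, \prod_e k e = \prod_e l e + L * y.
  by apply: (big_ind2 (fun a b => exists t, a = b + L * t)) => // e _; exists (t e).
have [z zE] : exists z, (q%:Z ^+ J) ^+ #|{: edges G}| = 1 + L * z.
  have [z zE] := expn_mod_sq L (J * #|{: edges G}|).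
  by exists ((J * #|{: edges G}|)%N%:Z + L * z); rewrite -exprM qE zE.
rewrite xE yE zE => E; rewrite LE in E.
have {}E : numer s l =
    (sgz (\prod_e l e) * r + y * r - x - z * (numer s l + L * x)) * L.
  transitivity ((1 + L * z) * (numer s l + L * x) - L * z * (numer s l + L * x) - L * x).
    ring.
  by rewrite E; ring.
rewrite E; apply: (@dvdz_trans L); last exact: dvdz_mull.
by rewrite /L abszEsg; apply: dvdz_mull.
Qed.

End Integrality.

(** * Small solutions *)

(** Each index excludes at most one of the [#|I| + 1] candidates. *)
Lemma ex_avoiding (I : finType) (s a : I -> int) :
  exists2 x : nat, (x <= #|I|)%N &
    forall i, (s i != 0) || (a i != 0) -> s i + a i * x%:Z != 0.
Proof.
pose ok (x : 'I_#|I|.+1) i := ((s i != 0) || (a i != 0)) ==> (s i + a i * x%:Z != 0).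
case: (boolP [exists x, [forall i, ok x i]]) => [/existsP[x /forallP okx]|].
  by exists x; [rewrite -ltnS|move=> i; apply/implyP/okx].
rewrite negb_exists => /forallP bad.
have /fin_all_exists[f fP] : forall x, exists i, ~~ ok x i.
  by move=> x; have := bad x; rewrite negb_forall => /existsP.
have /leq_card : injective f.
  move=> x y fxy; have := fP x; have := fP y; rewrite -fxy /ok !negb_imply !andbT.
  case: (eqVneq (a (f x)) 0) => [->|a0]; first by rewrite orbF !mul0r addr0 => /andP[/negPf ->].
  move=> /andP[_ /eqP Ey] /andP[_ /eqP Ex]; apply: val_inj; apply/eqP.
  by rewrite -eqz_nat -(inj_eq (mulfI a0)) -(inj_eq (addrI (s (f x)))) Ex Ey.
by rewrite card_ord ltnn.
Qed.

Lemma ex_generic_vector (I : finType) k (u : I -> 'I_k -> int) :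
  exists2 xi : 'I_k -> nat, forall j, (xi j <= #|I|)%N &
    forall i, (exists j, u i j != 0) -> \sum_j u i j * (xi j)%:Z != 0.
Proof.
elim: k u => [|k IH] u; first by exists (fun=> 0%N) => // i [[]].
have [xi xi_le xiP] := IH (fun i j => u i (lift ord_max j)).
have [x x_le xP] := ex_avoiding
  (fun i => \sum_j u i (lift ord_max j) * (xi j)%:Z) (fun i => u i ord_max).
exists (fun j => if unlift ord_max j is Some j' then xi j' else x).
  by move=> j; case: (unlift _ _).
move=> i [j uij]; rewrite (bigD1_ord ord_max) //= unlift_none addrC.
under eq_bigr do rewrite liftK.
apply: xP; case: (unliftP ord_max j) uij => [j' ->|->] ne; last by rewrite ne orbT.
by rewrite xiP //; exists j'.
Qed.

(** * The extension lattice as an integer kernel *)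

Section SmallExtension.

Variables (V : finType) (G : graph V) (nabla : edges G -> edges G -> edges G).
Variable c : edges G -> edges G -> int.

(** One orientation per edge, picked by an enumeration of the vertices; their labels are the
    unknowns. *)
Definition half_edges : {set edges G} :=
  [set e | enum_rank (src e) < enum_rank (dst e)]%N.

Lemma erev_half e : (erev e \in half_edges) = (e \notin half_edges).
Proof.
rewrite !inE -leqNgt ltn_neqAle; case: eqP => //= /val_inj /enum_rank_inj E.
have {}E : src e = dst e by [].
by have := valP e; rewrite -/(src e) -/(dst e) E adj_irr.
Qed.

Lemma card_half : (#|half_edges|.*2 = #|{: edges G}|)%N.
Proof.
rewrite -(cardsC half_edges) -addnn; congr (_ + _)%N.
rewrite -(card_imset half_edges (inv_inj (@erevK V G))).
apply: eq_card => e; rewrite [in RHS]inE; apply/imsetP/idP => [[f fh ->]|eh].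
  by rewrite erev_half fh.
by exists (erev e); rewrite ?erevK ?erev_half.
Qed.

Let N := #|half_edges|.
Let h (j : 'I_N) : edges G := enum_val j.

Let halfP e : (exists j, e = h j) \/ (exists j, e = erev (h j)).
Proof.
case: (boolP (e \in half_edges)) => [eh|].
  by left; exists (enum_rank_in eh e); rewrite /h enum_rankK_in.
rewrite -erev_half => eh; right; exists (enum_rank_in eh (erev e)).
by rewrite /h enum_rankK_in // erevK.
Qed.

(** Coefficients of the label of [e] in the unknowns: a single sign. *)
Let eps e (j : 'I_N) : int := (e == h j)%:R - (erev e == h j)%:R.

Let eps_erev e j : eps (erev e) j = - eps e j.
Proof. by rewrite /eps erevK opprB. Qed.

Let eps_h i j : eps (h i) j = (i == j)%:R.
Proof.
rewrite /eps (inj_eq enum_val_inj) [erev _ == _](_ : _ = false) ?subr0 //.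
apply/negP => /eqP E; have := enum_valP j; rewrite -/(h j) -E erev_half.
by rewrite (enum_valP i).
Qed.

Let eps_sum e : (\sum_j `|eps e j|%N <= 1)%N.
Proof.
have sum_h i : (\sum_j `|eps (h i) j|%N <= 1)%N.
  rewrite (bigD1 i) //= big1 => [|j /negPf ji]; first by rewrite eps_h eqxx.
  by rewrite eps_h eq_sym ji.
have [[j ->]|[j ->]] := halfP e; first exact: sum_h.
by under eq_bigr do rewrite eps_erev abszN.
Qed.

Let ext (x : 'rV[int]_N) e : int := \sum_j x 0 j * eps e j.

Let ext_erev x e : ext x (erev e) = - ext x e.
Proof. by rewrite /ext -sumrN; apply: eq_bigr => j _; rewrite eps_erev mulrN. Qed.

Let ext_h x j : ext x (h j) = x 0 j.
Proof.
rewrite /ext (bigD1 j) //= big1 => [|i /negPf ij]; first by rewrite eps_h eqxx mulr1 addr0.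
by rewrite eps_h eq_sym ij mulr0.
Qed.

Let ext_eq (l : edges G -> int) : (forall e, l (erev e) = - l e) ->
  ext (\row_j l (h j)) =1 l.
Proof.
move=> l_erev e; have [[j ->]|[j ->]] := halfP e; first by rewrite ext_h mxE.
by rewrite ext_erev ext_h mxE l_erev.
Qed.

(** Pairs not starting at one vertex give zero rows, so all pairs can index the matrix. *)
Let relation (p : edges G * edges G) j : int :=
  if p.2 \in star G (src p.1) then
    eps p.2 j - eps (nabla p.1 p.2) j - c p.1 p.2 * eps p.1 j
  else 0.

Let A : 'M[int]_(#|{: edges G * edges G}|, N) := \matrix_(i, j) relation (enum_val i) j.

Let kerA x : A *m x^T = 0 <->
  forall e, {in star G (src e), forall f, ext x f - ext x (nabla e f) = c e f * ext x e}.
Proof.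
have rowE e f : f \in star G (src e) ->
    (A *m x^T) (enum_rank (e, f)) 0 = ext x f - ext x (nabla e f) - c e f * ext x e.
  move=> fs; rewrite /ext mulr_sumr -!sumrB mxE; apply: eq_bigr => j _.
  by rewrite !mxE enum_rankK /relation /= fs; ring.
split=> [Ax0 e f fs|H].
  by apply/eqP; rewrite -subr_eq0 -rowE // Ax0 mxE.
apply/colP => i; rewrite [RHS]mxE -(enum_valK i); case: (enum_val i) => e f.
case: (boolP (f \in star G (src e))) => fs; first by rewrite rowE // H // subrr.
rewrite mxE big1 // => j _; rewrite !mxE enum_rankK /relation /= (negPf fs).
by rewrite mul0r.
Qed.

Lemma small_maximal_extension D : (1 < D)%N ->
  (forall e, {in star G (src e), forall f, (`|c e f|%N + 2 <= D)%N}) ->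
  exists k (gamma : edges G -> 'rV[int]_k),
  [/\ maximal_extension nabla c gamma, (k <= N)%N
    & forall e i, (`|gamma e 0%R i|%N <= D ^ N)%N].
Proof.
move=> D_gt1 cD.
have A_row i : (\sum_j `|A i j|%N <= D)%N.
  case E: (enum_val i) => [e f].
  case: (boolP (f \in star G (src e))) => fs; last first.
    by rewrite big1 // => j _; rewrite mxE E /relation /= (negPf fs).
  apply: (@leq_trans (\sum_j (`|eps f j| + `|eps (nabla e f) j| + `|c e f| * `|eps e j|))%N).
    apply: leq_sum => j _; rewrite mxE E /relation /= fs -abszM.
    by lia.
  rewrite !big_split /= -big_distrr /=.
  apply: (@leq_trans (1 + 1 + `|c e f|%N * 1)%N); last by rewrite muln1 addnC cD.
  by rewrite !leq_add // leq_mul.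
have [k [B [kN kerB genB indB leB]]] := small_kernel_basis D_gt1 A_row.
have extB a e : ext (a *m B) e = \sum_i a 0 i * ext (row i B) e.
  rewrite /ext; under [RHS]eq_bigr do rewrite mulr_sumr.
  rewrite exchange_big /=; apply: eq_bigr => j _; rewrite mxE mulr_suml.
  by apply: eq_bigr => i _; rewrite mxE; ring.
pose gamma e : 'rV[int]_k := \row_i ext (row i B) e.
have combE (a : 'I_k -> int) e :
    (\sum_i [ffun e => gamma e 0 i] *~ a i : {ffun edges G -> int}) e =
    ext ((\row_i a i) *m B) e.
  rewrite extB sum_ffunE; apply: eq_bigr => i _.
  rewrite ffunMzE ffunE !mxE mulrzz; ring.
exists k, gamma; split=> //; last first.
  move=> e i; rewrite mxE; have [[j ->]|[j ->]] := halfP e.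
    by rewrite ext_h mxE.
  by rewrite ext_erev abszN ext_h mxE.
split.
- move=> i; split=> [e|e f fs]; first by rewrite !ffunE !mxE ext_erev.
  by rewrite !ffunE !mxE; apply: (kerA _).1 fs; apply: kerB.
- move=> l [l_erev l_nabla].
  have extl := ext_eq l_erev; have [|a aE] := genB (\row_j l (h j)).
    by apply/kerA => e f fs; rewrite !extl l_nabla.
  exists (fun i => a 0 i); apply/ffunP => e; rewrite combE -extl aE.
  by congr (ext (_ *m _) _); apply/rowP => i; rewrite mxE.
- move=> a a0; suff /indB/rowP H : (\row_i a i) *m B = 0.
    by move=> i; have := H i; rewrite !mxE.
  by apply/rowP => j; rewrite -ext_h -combE a0 ffunE mxE.
Qed.

End SmallExtension.

(** * Chern numbers *)

Lemma elsym_card (R : pzSemiRingType) (I : finType) (A : {set I}) (y : I -> R) :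
  elsym A y #|A| = \prod_(e in A) y e.
Proof.
apply: big_pred1 => S /=.
apply/andP/eqP => [[SA /eqP E]|->]; last by rewrite subxx eqxx.
by apply/eqP; rewrite eqEcard SA E leqnn.
Qed.

Lemma prod_int_ge1 (R : numDomainType) (I : finType) (A : {set I}) (l : I -> int) :
  (forall e, l e != 0) -> 1 <= \prod_(e in A) `|(l e)%:~R : R|.
Proof.
move=> l0; elim/big_ind: _ => // [x y|e _]; first exact: mulr_ege1.
by rewrite -intr_norm -[1]/(1%:~R) ler_int -gtz0_ge1 normr_gt0.
Qed.

Section ChernNumber.

Variables (V : finType) (G : graph V).

Lemma chern_term_rmorph (R S : pzSemiRingType) (f : {rmorphism R -> S}) s
    (y : edges G -> R) v :
  f (chern_term s y v) = chern_term s (fun e => f (y e)) v.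
Proof.
apply: (@chern_term_rel _ _ _ _ (fun a b => f a = b)); rewrite ?rmorph0 ?rmorph1 //.
  by move=> a _ a' _ <- <-; rewrite rmorphD.
by move=> a _ a' _ <- <-; rewrite rmorphM.
Qed.

Lemma chern_numberE r (alpha : edges G -> 'rV[int]_r) s :
  chern_number alpha s = loc s (fun e => tofrac (linear_form (alpha e))).
Proof.
apply: eq_bigr => v _; rewrite -chern_term_rmorph.
congr (tofrac _ / _); last by rewrite rmorph_prod.
apply: eq_bigr => i _.
exact: (mesym_elsym (star G v) (fun e => linear_form (alpha e))).
Qed.

Lemma loc_intr (F : fieldType) s (l : edges G -> int) z :
  (forall e, (l e)%:~R != 0 :> F) -> numer s l = z * \prod_e l e ->
  loc s (fun e => (l e)%:~R : F) = z%:~R.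
Proof.
move=> l0 zE; rewrite locE // -(numer_rmorph (intr : {rmorphism int -> F})) zE rmorphM.
rewrite rmorph_prod mulfK //; apply/prodf_neq0 => e _; exact: l0.
Qed.

(** Denominators are products of nonzero integers, so dropping them can only enlarge the absolute
    values. *)
Lemma loc_norm_le (R : numFieldType) s (l : edges G -> int) n (b : R) :
  (forall v, #|star G v| = n) -> sumn s = n -> (forall e, l e != 0) ->
  (forall e, `|(l e)%:~R : R| <= b) ->
  `|loc s (fun e => (l e)%:~R : R)| <= #|V|%:R * b ^+ n * \prod_(i <- s) ('C(n, i))%:R.
Proof.
move=> hval hs l0 lb; apply: le_trans (ler_norm_sum _ _ _) _.
have -> : #|V|%:R * b ^+ n * \prod_(i <- s) ('C(n, i))%:R =
    \sum_(v : V) \prod_(i <- s) ('C(n, i)%:R * b ^+ i).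
  rewrite sumr_const -mulrA mulr_natl big_split mulrC /=; congr (_ * _ *+ _).
  by rewrite -hs; elim: {hs} s => [|i s IH]; rewrite ?big_nil //= big_cons exprD IH.
apply: ler_sum => v _; rewrite normrM normfV [X in _ / X]normr_prod.
have ge1 := prod_int_ge1 R (star G v) l0.
rewrite ler_pdivrMr; last exact: lt_le_trans ltr01 ge1.
rewrite /chern_term normr_prod.
apply: le_trans (_ : \prod_(i <- s) ('C(n, i)%:R * b ^+ i) <= _).
  apply: ler_prod => i _; rewrite normr_ge0 -(hval v); apply: elsym_norm_le => e _.
  exact: lb.
apply: ler_peMr; last exact: ge1.
apply: prodr_ge0 => i _.
apply: (le_trans (normr_ge0 (elsym (star G v) (fun e => (l e)%:~R : R) i))).
by rewrite -(hval v); apply: elsym_norm_le => e _; apply: lb.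
Qed.

End ChernNumber.

Section LinearForm.

Variable r : nat.
Implicit Types x y : 'rV[int]_r.

Lemma linear_formD x y : linear_form (x + y) = linear_form x + linear_form y.
Proof. by rewrite -big_split; apply: eq_bigr => j _; rewrite mxE scalerDl. Qed.

Lemma linear_formZ a x : linear_form (a *: x) = a%:~R * linear_form x.
Proof.
by rewrite mulrzl -scaler_int intz scaler_sumr; apply: eq_bigr => j _; rewrite mxE scalerA.
Qed.

Lemma linear_formN x : linear_form (- x) = - linear_form x.
Proof. by rewrite -scaleN1r linear_formZ mulrN1z mulN1r. Qed.

Lemma linear_form_eq0 x : (linear_form x == 0) = (x == 0).
Proof.
apply/eqP/eqP => [lx0|->]; last by rewrite /linear_form big1 // => j _; rewrite mxE scale0r.
apply/rowP => j; rewrite mxE.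
have := congr1 (mcoeff U_(j)) lx0; rewrite mcoeff0 raddf_sum /= (bigD1 j) //=.
rewrite mcoeffZ mcoeffX eqxx mulr1 big1 ?addr0 // => i /negPf ij.
by rewrite mcoeffZ mcoeffX eq_mnm1 ij mulr0.
Qed.

Lemma tofrac_int_eq0 (a : int) : (a%:~R == 0 :> {fraction {mpoly int[r]}}) = (a == 0).
Proof.
rewrite -(rmorph_int (@tofrac {mpoly int[r]})) tofrac_eq0.
by rewrite -(rmorph_int (@mpolyC r int)) intz mpolyC_eq0.
Qed.

End LinearForm.

Section GKMGraph.

Variables (V : finType) (G : graph V) (r : nat) (alpha : edges G -> 'rV[int]_r).
Variables (nabla : edges G -> edges G -> edges G) (c : edges G -> edges G -> int).
Hypothesis hGKM : GKM_graph alpha nabla c.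

Lemma card_edges n : valent G n -> #|{: edges G}| = (n * #|V|)%N.
Proof.
move=> hval; rewrite -sum1_card (partition_big (@src V G) predT) //=.
rewrite mulnC -sum_nat_const; apply: eq_bigr => v _.
by rewrite sum1dep_card -(hval v).
Qed.

Lemma axial_sum (I : finType) (l : I -> edges G -> int) (a : I -> int) :
  (forall i, axial nabla c (l i)) -> axial nabla c (fun e => \sum_i l i e * a i).
Proof.
move=> l_axial; split=> [e|e f fs].
  by rewrite -sumrN; apply: eq_bigr => i _; rewrite (l_axial i).1 mulNr.
rewrite mulr_sumr -sumrB; apply: eq_bigr => i _.
by rewrite -mulrBl (l_axial i).2 // mulrA.
Qed.

Lemma axial_coord j : axial nabla c (fun e => alpha e 0 j).
Proof.
have [_ alpha_erev _ alpha_nabla] := hGKM; split=> [e|e f fs].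
  by rewrite alpha_erev mxE.
by have /rowP/(_ j) := alpha_nabla e f fs; rewrite !mxE intz.
Qed.

(** A second edge at the same vertex has an independent label, which forces both to be nonzero. *)
Lemma alpha_neq0 n : valent G n -> n != 1%N -> forall e, alpha e != 0.
Proof.
move=> hval n1 e; have [indep _ _ _] := hGKM.
have [f fs fe] : exists2 f, f \in star G (src e) & f != e.
  apply/exists_inP; apply: contraR n1; rewrite negb_exists => /forallP H.
  rewrite -(hval (src e)) (cardsD1 e) mem_star_src add1n eqSS cards_eq0 -subset0.
  apply/subsetP => f; rewrite !inE => /andP[fe fs].
  by have := H f; rewrite inE fs fe.
apply/eqP => e0; rewrite eq_sym in fe.
have [] := indep _ e f (mem_star_src e) fs fe 1 0; last by move/eqP; rewrite oner_eq0.
by rewrite e0 scaler0 scale0r addr0.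
Qed.

(* Every coordinate of [alpha] is an integral combination of the coordinates of
   a maximal extension. *)
Lemma maximal_extension_neq0 k (gamma : edges G -> 'rV[int]_k) e :
  maximal_extension nabla c gamma -> alpha e != 0 -> exists i, gamma e 0 i != 0.
Proof.
case=> _ gen _ ae0; apply/existsP; apply: contraR ae0; rewrite negb_exists => /forallP g0.
apply/eqP/rowP => j; rewrite mxE.
have [ax1 ax2] := axial_coord j.
have [|a] := gen [ffun e => alpha e 0 j].
  split=> [f|f g gs]; first by rewrite !ffunE ax1.
  by rewrite !ffunE ax2 // intz.
move/ffunP/(_ e); rewrite ffunE => ->; rewrite sum_ffunE big1 // => i _.
by rewrite ffunMzE ffunE (eqP (negbNE (g0 i))) mul0rz.
Qed.

Lemma maximal_extension_axial k (gamma : edges G -> 'rV[int]_k) i :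
  maximal_extension nabla c gamma -> axial nabla c (fun e => gamma e 0 i).
Proof.
case=> /(_ i) [g1 g2] _ _; split=> [e|e f fs]; first by have := g1 e; rewrite !ffunE.
by have := g2 e f fs; rewrite !ffunE intz.
Qed.

(** A generic combination of the [k] coordinates, with coefficients at most the number of edges,
    avoids zero on every edge. *)
Lemma small_axial k (gamma : edges G -> 'rV[int]_k) b :
  maximal_extension nabla c gamma -> (forall e, alpha e != 0) ->
  (forall e i, (`|gamma e 0%R i|%N <= b)%N) ->
  exists l : edges G -> int, [/\ axial nabla c l, forall e, l e != 0
    & forall e, (`|l e|%N <= k * (b * #|{: edges G}|))%N].
Proof.
move=> gmax a0 gb.
have [xi xi_le xiP] := ex_generic_vector (fun e i => gamma e 0 i).
exists (fun e => \sum_i gamma e 0 i * (xi i)%:Z); split.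
- by apply: axial_sum => i; apply: maximal_extension_axial.
- by move=> e; apply/xiP/maximal_extension_neq0.
move=> e; rewrite -[X in (_ <= X * _)%N]card_ord -sum_nat_const.
elim/big_ind2: _ => // [x m y n h1 h2|i _]; first by apply: leq_trans (leq_add h1 h2); lia.
by rewrite abszM; apply: leq_mul; [exact: gb|exact: xi_le].
Qed.

Section Chern.

Variables (n : nat) (s : seq nat).
Hypothesis hval : valent G n.
Hypothesis hs : sumn s = n.
Variable l : edges G -> int.
Hypothesis l_axial : axial nabla c l.
Hypothesis l_neq0 : forall e, l e != 0.
Hypothesis a_neq0 : forall e, alpha e != 0.

Let card_star v : #|star G v| = sumn s. Proof. by rewrite hs. Qed.

Let cross_neq0 v : {in star G v &, forall e f, e != f -> l e *: alpha f - l f *: alpha e != 0}.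
Proof.
move=> e f es fs ef; have [indep _ _ _] := hGKM; apply/eqP.
rewrite addrC -scaleNr => /(indep v e f es fs ef) [_ /eqP].
by rewrite (negPf (l_neq0 e)).
Qed.

Lemma numer_dvd : (\prod_e l e %| numer s l)%Z.
Proof.
have [_ _ nablaP _] := hGKM.
pose cross (p : edges G * edges G) :=
  (p.1 != p.2) && (p.2 \in star G (src p.1)).
(* One generic vector meets both demands on [m]: pairs in [cross] give transversality to [l],
   diagonal pairs give [m e != 0]. *)
pose u p : 'rV[int]_r :=
  if cross p then l p.1 *: alpha p.2 - l p.2 *: alpha p.1 else alpha p.1.
have [xi _ xiP] := ex_generic_vector (fun p j => u p 0 j).
have u_neq0 p : u p != 0.
  rewrite /u; case: ifP => [/andP[ef fs]|_]; last exact: a_neq0.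
  exact: cross_neq0 (mem_star_src _) fs ef.
have uP p : exists j, u p 0 j != 0.
  apply/existsP; apply: contraR (u_neq0 p); rewrite negb_exists => /forallP u0.
  by apply/eqP/rowP => j; rewrite mxE (eqP (negbNE (u0 j))).
pose m e := \sum_j alpha e 0 j * (xi j)%:Z.
have m_axial : axial nabla c m by apply: axial_sum => j; apply: axial_coord.
have m_neq0 e : m e != 0.
  by have := xiP (e, e) (uP _); rewrite /u /cross /= eqxx.
have lm_neq v : {in star G v &, forall e f, e != f -> l e * m f != l f * m e}.
  move=> e f es fs ef; have := xiP (e, f) (uP _).
  have fse : f \in star G (src e) by move: es fs; rewrite !inE => /eqP ->.
  rewrite /u /cross /= ef fse -[_ == l f * _]subr_eq0 /m !mulr_sumr -sumrB.
  by apply: contra_neq => E; rewrite -[RHS]E; apply: eq_bigr => j _; rewrite !mxE; ring.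
apply: (numer_dvd_of_q nablaP card_star l_axial m_axial l_neq0 m_neq0 lm_neq
  (q := (absz (\prod_e l e)).+1)); last by rewrite intS.
by rewrite ltnS absz_gt0; apply/prodf_neq0 => e _; apply: l_neq0.
Qed.

(** The deformation argument between [l] and the linear forms of [alpha]; transversality comes from
    independence at each vertex. *)
Lemma chern_number_axial :
  chern_number alpha s = loc s (fun e => (l e)%:~R : {fraction {mpoly int[r]}}).
Proof.
have [_ alpha_erev nablaP alpha_nabla] := hGKM.
rewrite chern_numberE; apply: esym; apply: (loc_axial_eq nablaP (c := c)) => //.
- by rewrite -[2]/(2%:Z%:~R) tofrac_int_eq0.
- split=> [e|e f fs]; first by rewrite l_axial.1 rmorphN.
  by rewrite -rmorphB l_axial.2 // intz rmorphM.
- split=> [e|e f fs]; first by rewrite alpha_erev linear_formN tofracN.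
  rewrite -tofracB -linear_formN -linear_formD alpha_nabla //.
  by rewrite linear_formZ tofracM rmorph_int.
- by move=> e; rewrite tofrac_int_eq0.
- by move=> e; rewrite tofrac_eq0 linear_form_eq0.
move=> v e f es fs ef; have := cross_neq0 es fs ef.
rewrite -linear_form_eq0 -tofrac_eq0 linear_formD linear_formN !linear_formZ.
by rewrite tofracB !tofracM !rmorph_int subr_eq0.
Qed.

Lemma chern_number_bound (R : numFieldType) (b : nat) :
  (forall e, (`|l e|%N <= b)%N) ->
  exists2 z : int, chern_number alpha s = z%:~R &
    `|z|%:~R <= #|V|%:R * b%:R ^+ n * \prod_(i <- s) ('C(n, i))%:R :> R.
Proof.
move=> lb; have /dvdzP[z zE] := numer_dvd; exists z.
  by rewrite chern_number_axial (loc_intr (z := z)) // => e; rewrite tofrac_int_eq0.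
rewrite intr_norm -(loc_intr (l := l) (s := s)) //; last by move=> e; rewrite intr_eq0.
apply: loc_norm_le => // e; rewrite -intr_norm.
by rewrite -[b%:R]/(b%:Z%:~R) ler_int -abszE lez_nat.
Qed.

End Chern.

End GKMGraph.

(** Each vertex contributes [a / a], which is 1, or 0 by the convention [0^-1 = 0] if the label
    vanishes. *)
Lemma chern_number_valent1 (V : finType) (G : graph V) r (alpha : edges G -> 'rV[int]_r) :
  valent G 1 ->
  exists2 z : int, chern_number alpha [:: 1%N] = z%:~R & `|z| <= #|V|%:Z.
Proof.
move=> hval; rewrite chern_numberE.
pose a v := \prod_(e in star G v) (tofrac (linear_form (alpha e))).
exists (\sum_v (a v != 0 : nat)%:Z).
  rewrite rmorph_sum; apply: eq_bigr => v _.
  rewrite /chern_term big_seq1 -[in LHS](hval v) elsym_card -/(a v).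
  by case: eqVneq => [->|a0]; [rewrite mul0r|rewrite divff].
apply: le_trans (ler_norm_sum _ _ _) _.
rewrite -[#|V|%:Z]natz -sumr_const; apply: ler_sum => v _.
by case: (a v != 0).
Qed.

(** * Numerical estimates and conclusion *)

Lemma Kbound_sqr (R : rcfType) (beta : R) (n chi N D : nat) :
  (N.*2 = n * chi)%N -> D%:R <= beta ^+ 2 + 2 ->
  ((n + 3) * N)%:R * ((D ^ N)%:R) ^+ 2 <= 4 * Kbound beta n chi ^+ 2.
Proof.
move=> hN hD; have hB : 0 <= beta ^+ 2 + 2 by rewrite addr_ge0 ?sqr_ge0.
rewrite sqr_sqrtr; last by rewrite divr_ge0 // mulr_ge0 // exprn_ge0.
have hpow : ((D ^ N)%:R : R) ^+ 2 <= (beta ^+ 2 + 2) ^+ (n * chi).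
  by rewrite -hN -muln2 natrX -exprM lerXn2r // nnegrE.
(* With [n * chi = 2 N], the quantity [4 K^2] is [(n + 3) N (beta^2 + 2)^(2 N)]. *)
have -> : ((n + 3) * n * chi)%:R = ((n + 3) * N)%:R * 2 :> R.
  by rewrite -mulnA -hN -muln2 mulnA natrM.
set x := _%:R; set y := _ ^+ 2 in hpow *; set z := _ ^+ (n * chi) in hpow *.
have -> : 4 * (x * 2 * z / 8) = x * z by field.
by rewrite ler_wpM2l.
Qed.

Lemma expn_le_Kbound (R : rcfType) (beta : R) (n chi N D : nat) :
  (N.*2 = n * chi)%N -> (0 < N)%N -> D%:R <= beta ^+ 2 + 2 ->
  (D ^ N)%:R <= Kbound beta n chi.
Proof.
move=> hN N0 hD; have := Kbound_sqr hN hD.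
set y : R := _%:R; set x : R := (_ * _)%:R => le_xy.
(* [N > 0] forces [n >= 1], so [(n + 3) N >= 4] offsets the factor 4. *)
have x4 : 4 <= x.
  by rewrite /x ler_nat; case: n hN {le_xy x} N0 => [|n]; case: N => // N; lia.
rewrite -(@ler_pXn2r _ 2) ?nnegrE ?sqrtr_ge0 // -(@ler_pM2l _ 4) //.
by apply: le_trans le_xy; rewrite ler_wpM2r ?sqr_ge0.
Qed.

(** The left side bounds [l]: at most [N] coordinates, entries at most [D ^ N], coefficients at most
    [2 N]. As [N <= D ^ N], it is at most [2 N D^(2 N) <= 2 K^2], and [2 <= n] gives the rest. *)
Lemma le_Lbound (R : rcfType) (beta : R) (n chi N D : nat) :
  (N.*2 = n * chi)%N -> (0 < N)%N -> (1 < D)%N -> (1 < n)%N ->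
  D%:R <= beta ^+ 2 + 2 ->
  let K := Kbound beta n chi in
  (N * (D ^ N * N.*2))%:R <= n%:R * K * (K + 1) ^+ n.-1.
Proof.
move=> hN N0 D1 n1 hD /=; set K := Kbound _ _ _.
have hK : (D ^ N)%:R <= K by exact: expn_le_Kbound.
have K0 : 0 <= K by apply: le_trans hK.
have := Kbound_sqr hN hD; rewrite -/K => hK2.
apply: (@le_trans _ _ (2 * K * K)); last first.
  apply: ler_pM => //; first by rewrite mulr_ge0.
    by rewrite ler_wpM2r // ler_nat.
  apply: (@le_trans _ _ (K + 1)); first by rewrite lerDl.
  rewrite -[leLHS]expr1; apply: ler_weXn2l; last by lia.
  by rewrite lerDr.
have h1 : (N * (D ^ N * N.*2) <= 2 * (N * (D ^ N) ^ 2))%N.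
  have NP : (N <= D ^ N)%N by rewrite ltnW // ltn_expl.
  have := leq_mul (leqnn (N * D ^ N)%N) NP.
  by rewrite -mulnn -muln2; lia.
apply: (@le_trans _ _ (2 * (N * (D ^ N) ^ 2))%:R); first by rewrite ler_nat.
rewrite natrM -mulrA ler_wpM2l // -(@ler_pM2l _ 4) // -expr2.
apply: le_trans hK2; rewrite -natrX -!natrM ler_nat mulnA leq_mul2r.
by apply/orP; right; rewrite leq_mul2r; lia.
Qed.

Theorem theorem1p3 (R : rcfType) (n r : nat) (V : finType) (G : graph V)
    (alpha : edges G -> 'rV[int]_r) (nabla : edges G -> edges G -> edges G)
    (c : edges G -> edges G -> int) (beta : R)
    (hval : valent G n) (hGKM : GKM_graph alpha nabla c) (hbeta : 0 < beta)
    (hc : forall e f : edges G, f \in star G (src e) -> `|c e f|%:~R <= beta) :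
  let chi := #|V| in
  let K := Kbound beta n chi in
  (exists (k : nat) (gamma : edges G -> 'rV[int]_k),
      maximal_extension nabla c gamma /\
      (forall e : edges G, (sup_norm (gamma e))%:R <= K)) /\
  (forall s : seq nat, all (fun i => 0 < i)%N s -> sumn s = n ->
      exists2 z : int, chern_number alpha s = z%:~R &
        `|z|%:~R <= chi%:R * (n%:R * K * (K + 1) ^+ n.-1) ^+ n
                    * \prod_(i <- s) ('C(n, i))%:R).
Proof.
move=> chi K.
pose N := #|half_edges G|.
have hN : (N.*2 = n * chi)%N by rewrite card_half (card_edges hval).
(* For a natural number [|c| <= |c|^2], so this integer lies between [|c| + 2] and [beta^2 + 2] even
   when [beta < 1]. *)
pose D := (\max_(p : edges G * edges G | p.2 \in star G (src p.1)) `|c p.1 p.2| ^ 2 + 2)%N.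
have D1 : (1 < D)%N by rewrite /D addn2.
have hD : D%:R <= beta ^+ 2 + 2.
  rewrite natrD lerD2r; apply: (big_ind (fun x : nat => x%:R <= beta ^+ 2)).
  - by rewrite sqr_ge0.
  - by move=> x y hx hy; rewrite /maxn; case: ifP.
  move=> p ps; rewrite natrX lerXn2r ?nnegrE ?(ltW hbeta) //.
  by have := hc p.1 p.2 ps; rewrite -abszE.
have cD e : {in star G (src e), forall f, (`|c e f|%N + 2 <= D)%N}.
  move=> f fs; rewrite leq_add2r.
  apply: (@leq_trans (`|c e f| ^ 2)%N); first by case: `|c e f|%N => // m; rewrite leq_pmulr.
  exact: (@leq_bigmax_cond _ _ (fun p : edges G * edges G => `|c p.1 p.2| ^ 2)%N (e, f)).
have N0 (e : edges G) : (0 < N)%N.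
  by rewrite -double_gt0 card_half; apply/card_gt0P; exists e.
have [k [gamma [gmax kN gD]]] := small_maximal_extension nabla D1 cD.
split.
  exists k, gamma; split=> // e; apply: le_trans (expn_le_Kbound hN (N0 e) hD).
  by rewrite ler_nat; apply/bigmax_leqP => i _; apply: gD.
(* At valence one the independence condition is empty and [alpha] may vanish on edges; the only
   decomposition is then [[:: 1]]. *)
move=> s s_pos hs; case: (eqVneq n 1%N) => [n1|n_neq1].
  have sE : s = [:: 1%N].
    move: s_pos hs; rewrite n1; case: s => // x [|y s] /=; first by rewrite addn0 => _ ->.
    by case/and3P => x0 y0 _; lia.
  move: (hval); rewrite n1 => hval1; have [z zE zV] := chern_number_valent1 alpha hval1.
  exists z; rewrite sE; first exact: zE.
  rewrite big_seq1 expr1 mulr1 mul1r expr0 mulr1.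
  have [V0|V0] := posnP chi; first by move: zV; rewrite -/chi V0 mul0r lerz0.
  have K1 : 1 <= K.
    apply: le_trans (expn_le_Kbound hN _ hD); first by rewrite ler1n expn_gt0 ltnW.
    by rewrite -double_gt0 hN n1 mul1n.
  apply: (@le_trans _ _ (chi%:Z%:~R)); first by rewrite ler_int.
  by rewrite ler_peMr.
have a0 := alpha_neq0 hGKM hval n_neq1.
have [l [l_axial l0 lb]] := small_axial hGKM gmax a0 gD.
have [z zE zb] := chern_number_bound hGKM hval hs l_axial l0 a0 R lb.
exists z => //; apply: le_trans zb _.
rewrite ler_wpM2r ?prodr_ge0 //.
have [V0|V0] := posnP chi; first by rewrite -/chi V0 !mul0r.
rewrite ler_wpM2l //; case: (posnP n) => [->|n0]; first by rewrite !expr0.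
have N_gt0 : (0 < N)%N by rewrite -double_gt0 hN muln_gt0 n0.
have n_gt1 : (1 < n)%N by lia.
rewrite lerXn2r ?nnegrE //.
  by rewrite !mulr_ge0 // ?exprn_ge0 // ?addr_ge0 // sqrtr_ge0.
apply: le_trans (le_Lbound hN N_gt0 D1 n_gt1 hD).
by rewrite ler_nat -card_half leq_mul.
Qed.
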